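(* For every fixed $\alpha\in(0,1)$ and $K=n^\alpha$, w.h.p. as $n\to\infty$, $$\Psi^{\mathcal{N}(1/2,1/4)}_K=\frac{K^2}{4}+\frac{K^{3/2}\sqrt{\log(n/K)}}{2}+o\left(K^{3/2}\sqrt{\log n}\right).$$
   Context: $K=n^\alpha$ is regarded as an integer, i.e. $K=\lfloor n^\alpha\rfloor$. Let $Z_{ij}$, $1\le i<j\le n$, be i.i.d. normal random variables with mean $1/2$ and variance $1/4$. For $S\subset\{1,\dots,n\}$ let $Z_S=\sum_{1\le i<j\le n,\ i,j\in S}Z_{ij}$ and $$\Psi^{\mathcal{N}(1/2,1/4)}_K=\max_{S\subset\{1,\dots,n\},\,|S|=K}Z_S .$$ ''W.h.p.'' means with probability tending to $1$; the statement with the $o(f_n)$ term means that for every $\varepsilon>0$ the absolute difference between the left-hand side and the explicit terms is at most $\varepsilon f_n$ with probability tending to $1$. *)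

(* Defs.v *)
From HB Require Import structures.
From mathcomp Require Import all_boot all_order all_algebra.
From mathcomp Require Import all_classical all_reals all_analysis.

Set Implicit Arguments.
Unset Strict Implicit.
Unset Printing Implicit Defensive.

Import Order.TTheory GRing.Theory Num.Theory.
Import numFieldNormedType.Exports.

Local Open Scope classical_set_scope.
Local Open Scope ring_scope.

(* Mutual independence of the subfamily (X i)_(i in D). *)
Definition mutually_independent d (T : measurableType d) (R : realType)
    (P : probability T R) (I : finType) (D : {set I})
    (X : I -> {RV P >-> R}) : Prop :=
  forall (J : {set I}) (B : I -> set R),
    J \subset D -> (forall i, measurable (B i)) ->
    P [set w | forall i, i \in J -> B i (X i w)] =
    (\prod_(i in J) P (X i @^-1` B i))%E.

(* [s] is the standard deviation, as in [normal_prob].  The two measures are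
   compared on measurable sets only: a library measure is a function on all
   sets, with no constraint outside the sigma-algebra. *)
Definition normally_distributed d (T : measurableType d) (R : realType)
    (P : probability T R) (X : {RV P >-> R}) (m s : R) : Prop :=
  forall A : set R, measurable A -> distribution P X A = normal_prob m s A.

(* Only the variables [Z i j] with [i < j] are constrained. *)
Definition iid_normal d (T : measurableType d) (R : realType)
    (P : probability T R) (n : nat) (Z : 'I_n -> 'I_n -> {RV P >-> R})
    (m s : R) : Prop :=
  mutually_independent [set p : 'I_n * 'I_n | (p.1 < p.2)%N]%SET
    (fun p : 'I_n * 'I_n => Z p.1 p.2) /\
  (forall i j : 'I_n, (i < j)%N -> normally_distributed (Z i j) m s).

Definition subset_weight (R : realType) (n : nat) (z : 'I_n -> 'I_n -> R)
    (S : {set 'I_n}) : R :=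
  \sum_(i in S) \sum_(j in S | (i < j)%N) z i j.

(* The maximum is taken in the extended reals, so that the empty maximum
   (k > n) is -oo. *)
Definition max_weight (R : realType) (n : nat) (z : 'I_n -> 'I_n -> R)
    (k : nat) : \bar R :=
  \big[Order.max/-oo%E]_(S : {set 'I_n} | #|S| == k) (subset_weight z S)%:E.

Definition subset_size (R : realType) (alpha : R) (n : nat) : nat :=
  Num.truncn (n%:R `^ alpha).

(* Main.v *)
Require Import Defs.
From HB Require Import structures.
From mathcomp Require Import all_boot all_order all_algebra.
From mathcomp Require Import all_classical all_reals all_analysis.
From mathcomp Require Import measurable_realfun measurable_fun_approximation.
From mathcomp Require Import ring lra.

Set Implicit Arguments.
Unset Strict Implicit.
Unset Printing Implicit Defensive.

Import Order.TTheory GRing.Theory Num.Theory.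
Import numFieldNormedType.Exports.

Local Open Scope classical_set_scope.
Local Open Scope ring_scope.

(** Write [x i j = Z i j - 1/2], [K] for the size of the sets and [n] for the
    number of vertices.  The weight of a [K]-set is [K (K - 1) / 4] plus a
    centered Gaussian of variance [K (K - 1) / 8], and there are about
    [exp (K ln (n / K))] such sets.  Were these Gaussians independent, their
    maximum would be about [K^(3/2) sqrt (ln (n / K)) / 2]; the theorem says that
    the dependence does not change the leading order.

    All probability enters through [prob_le_exp_sum]: if the indicator of an
    event is pointwise at most a linear combination of exponentials of linear
    forms in the [x i j], its probability is at most the same combination of
    the explicit Gaussian moment generating functions.  What remains is to find
    good pointwise bounds.

    The upper bound ([upper_tail]) is the union bound.

    The lower bound ([lower_tail]) is a second moment argument.  Two obstacles
    have to be removed.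

    First, the plain second moment fails for [alpha >= 2/3], because two
    typical [K]-sets share about [K^2 / n] vertices and this already makes
    their weights too correlated. So only transversals of [K] disjoint blocks
    of [m = n / K] vertices are used: there are [m ^ K] of them, which is the
    number of [K]-sets up to a factor [exp (O (K))]. The indicator of a
    transversal is replaced by its centering, whose mean over each block is
    zero. The quadratic forms [Y_a] so obtained have nearly the same variance
    as the weights, while the covariance of [Y_a] and [Y_b] is at most [(N -
    K/m)^2 / 8], where [N] is the number of blocks in which [a] and [b] agree;
    as [N] has mean [K/m], typical pairs are nearly uncorrelated. What has
    been dropped from the weights has variance [O (K^2 / m)], hence is
    negligible uniformly over all transversals by a union bound
    ([edge_dot_residual]).

    Second, pairs with a large overlap dominate the second moment of the
    partition function [sum_a exp (beta Y_a)] close to the critical [beta].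
    They are controlled by keeping only the terms with [Y_a] near its typical
    value [beta v] under the tilted measure ([truncated_second_moment]); the
    truncation is itself bounded by exponentials.  Then a pair with overlap
    [rho K] contributes a factor [exp (K L (2 rho^2 / (1 + rho^2) - rho))], up to
    lower order terms in the exponent, with [L = ln m], and
    [2 rho^2 / (1 + rho^2) <= rho] for every [rho] in [[0, 1]].  This is
    the inequality behind [high_overlap_exponent]; small overlaps are treated in
    [low_overlap_exponent].  Hence the normalized second moment tends to one and
    some [Y_a] is large with probability tending to one.

    The error terms are negligible because [K] and [m] grow faster than any
    multiple of the cube of [ln n] ([growth_conditions]). *)

(** * Integrals of products of independent variables *)

Import HBNNSimple.

(** Used twice: with [phi] the identity it integrates against a density, and with
    [nu] a multiple of the law of [phi] it factors an expectation. *)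
Lemma ge0_integral_image_density d d' (T : measurableType d)
    (T' : measurableType d') (R : realType)
    (mu : {measure set T -> \bar R}) (nu : {measure set T' -> \bar R})
    (phi : T -> T') (g : T -> R) (f : T' -> \bar R) :
  measurable_fun [set: T] phi -> measurable_fun [set: T] g ->
  (forall x, 0 <= g x) ->
  (forall B, measurable B -> nu B = \int[mu]_(x in phi @^-1` B) (g x)%:E)%E ->
  measurable_fun [set: T'] f -> (forall y, (0 <= f y)%E) ->
  (\int[nu]_y f y = \int[mu]_x (f (phi x) * (g x)%:E))%E.
Proof.
move=> mphi mg g0 nuE mf f0.
pose f_ := nnsfun_approx measurableT mf.
have mpre B : measurable B -> measurable (phi @^-1` B).
  by move=> mB; rewrite -(setTI (_ @^-1` _)); exact: mphi.
have g0' x : (0 <= (g x)%:E)%E by rewrite lee_fin.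
have -> : (\int[nu]_y f y = limn (fun n => \int[nu]_y (f_ n y)%:E))%E.
  rewrite -monotone_convergence//=.
  - apply: eq_integral => y _; apply/esym/cvg_lim => //.
    exact: cvg_nnsfun_approx.
  - by move=> n; exact/measurable_EFinP/measurable_funP.
  - by move=> n y _; rewrite lee_fin.
  - by move=> y _ m n mn; rewrite lee_fin; exact/lefP/nd_nnsfun_approx.
have mfg n : measurable_fun [set: T] (fun x => (f_ n (phi x))%:E * (g x)%:E)%E.
  apply: emeasurable_funM; last exact/measurable_EFinP.
  exact/measurable_EFinP/measurableT_comp.
have ndfg x : nondecreasing_seq (fun n => (f_ n (phi x))%:E * (g x)%:E)%E.
  move=> a b ab; rewrite lee_wpmul2r// lee_fin.
  exact/lefP/nd_nnsfun_approx.
transitivity (limn (fun n => \int[mu]_x ((f_ n (phi x))%:E * (g x)%:E))%E);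
  last first.
  rewrite -monotone_convergence//=; last first.
  - by move=> n x _; rewrite mule_ge0// lee_fin.
  - apply: eq_integral => x _; apply/cvg_lim => //.
    apply: cvgeZr => //.
    by apply: cvg_nnsfun_approx => //.
congr (limn _); apply/funext => n.
under eq_integral do rewrite fimfunE -fsumEFin//.
have mind r : measurable_fun [set: T'] (\1_(f_ n @^-1` [set r]) : T' -> R) by [].
rewrite ge0_integral_fsum//; last 2 first.
- by move=> r; exact/measurable_EFinP/measurable_funM.
- by move=> r x _; rewrite EFinM nnfun_muleindic_ge0.
under [RHS]eq_integral.
  move=> x xD; rewrite fimfunE -fsumEFin// ge0_mule_fsuml; last first.
    by move=> r; rewrite EFinM nnfun_muleindic_ge0.
  over.
rewrite [RHS]ge0_integral_fsum//; last 2 first.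
- move=> r; apply: emeasurable_funM; last exact/measurable_EFinP.
  apply/measurable_EFinP/measurable_funM => //.
  exact: (measurableT_comp (mind r)).
- by move=> r x _; rewrite mule_ge0// EFinM nnfun_muleindic_ge0.
apply: eq_fsbigr => r rr; rewrite integralZl_indic_nnsfun//=.
rewrite integral_indic//= setIT.
have r0 : (0 <= r%:E)%E.
  by move: rr => /set_mem[t _ <-]; rewrite lee_fin.
under [RHS]eq_integral do rewrite EFinM -muleA.
rewrite ge0_integralZl//; last 2 first.
- apply: emeasurable_funM; last exact/measurable_EFinP.
  exact/measurable_EFinP/(measurableT_comp (mind r)).
- by move=> x _; rewrite mule_ge0// lee_fin.
rewrite nuE//; congr (_ * _)%E.
rewrite integral_mkcond; apply: eq_integral => x _.
rewrite patchE indicE.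
have -> : (phi x \in f_ n @^-1` [set r]) = (x \in phi @^-1` (f_ n @^-1` [set r])).
  by apply/idP/idP => /set_mem ?; apply/mem_set.
by case: ifP; rewrite ?mul1e ?mul0e.
Qed.

Lemma measurable_prod_cond d (T : measurableType d) (R : realType)
    (I : finType) (Q : pred I) (h : I -> T -> R) :
  (forall i, measurable_fun [set: T] (h i)) ->
  measurable_fun [set: T] (fun w => \prod_(i | Q i) h i w).
Proof.
move=> mh; under eq_fun do rewrite -big_filter.
by apply: measurable_prod.
Qed.

Lemma measurable_forall_fin d (T : measurableType d) (I : finType)
    (Q : I -> Prop) (A : I -> set T) :
  (forall i, measurable (A i)) -> measurable [set w | forall i, Q i -> A i w].
Proof.
move=> mA.
rewrite -[X in measurable X]/(\bigcap_(i in Q) A i).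
by apply: fin_bigcap_measurable => //; exact: finite_finset.
Qed.

(** Independence is the case where every [f i] is an indicator.  The general case
    follows by changing the indicators into arbitrary factors one index at a
    time: with all other factors fixed, both sides are integrals of [f i] against
    measures that agree on measurable sets. *)
Lemma independent_integral_prod d (T : measurableType d) (R : realType)
    (P : probability T R) (I : finType) (D : {set I}) (X : I -> {RV P >-> R})
    (f : I -> R -> R) (e : I -> R) :
  mutually_independent D X ->
  (forall i, measurable_fun [set: R] (f i)) -> (forall i x, 0 <= f i x) ->
  (forall i, \int[P]_w (f i (X i w))%:E = (e i)%:E)%E ->
  (\int[P]_w (\prod_(i in D) f i (X i w))%:E = (\prod_(i in D) e i)%:E)%E.
Proof.
move=> indep; have : forall i, i \in D -> i \notin enum I ->
    exists2 B, measurable B & f i = \1_B.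
  by move=> i _; rewrite mem_enum.
elim: (enum I) f e => [|i s IH] f e fB mf f0 fe.
- have [B BP] : {B : I -> set R & forall i, measurable (B i) /\
      (i \in D -> f i = \1_(B i))}.
    apply: (@boolp.choice _ _
      (fun i B => measurable B /\ (i \in D -> f i = \1_B))) => i.
    have [iD|iD] := boolP (i \in D).
      by have [B mB ->] := fB i iD isT; exists B.
    by exists setT; split.
  have mB i : measurable (B i) by have [] := BP i.
  have fE i : i \in D -> f i = \1_(B i) by have [] := BP i.
  have mpre i : measurable (X i @^-1` B i).
    by rewrite -(setTI (_ @^-1` _)); exact: measurable_funP.
  have eE i : i \in D -> (e i)%:E = P (X i @^-1` B i).
    move=> iD; rewrite -fe; under eq_integral do rewrite (fE _ iD).
    by rewrite (integral_indic _ measurableT (mpre i)) setIT.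
  have ->  : (\prod_(i in D) e i)%:E = (\prod_(i in D) P (X i @^-1` B i))%E.
    by rewrite -prodEFin; apply: eq_bigr => i /eE.
  have mE : measurable [set w | forall i, i \in D -> B i (X i w)].
    exact: (@measurable_forall_fin _ _ _ (fun i => i \in D)
      (fun i => X i @^-1` B i)).
  rewrite -indep//.
  transitivity
    (\int[P]_w (\1_[set w | forall i, i \in D -> B i (X i w)] w)%:E)%E;
    last first.
    by rewrite integral_indic// setIT.
  apply: eq_integral => w _; congr EFin; rewrite indicE.
  have [wE|wE] := boolP (w \in _).
    rewrite big1// => i iD; rewrite fE// indicE mem_set//.
    by move/set_mem : wE; apply.
  have /existsNP[i /not_implyP[iD nB]] : ~ (forall i, i \in D -> B i (X i w)).
    by move=> h; move/negP: wE; apply; exact: mem_set.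
  by rewrite (bigD1 i)//= fE// indicE memNset// mul0r.
- have [iD|iD] := boolP (i \in D); last first.
    apply: IH => // j jD js; apply: fB => //.
    by rewrite inE negb_or js andbT; apply: contraNneq iD => <-.
  pose g w := \prod_(j in D | j != i) f j (X j w).
  pose c := \prod_(j in D | j != i) e j.
  have c0 : 0 <= c.
    apply: prodr_ge0 => j _; rewrite -lee_fin -fe.
    by apply: integral_ge0 => w _; rewrite lee_fin.
  have mg : measurable_fun [set: T] g.
    by apply: measurable_prod_cond => j; apply: measurableT_comp => //; exact: mf.
  have g0 w : 0 <= g w by apply: prodr_ge0.
  (* Replacing f i by an indicator lowers the number of general factors. *)
  have nuE B : measurable B ->
    (mscale (NngNum c0) (distribution P (X i)) B
      = \int[P]_(w in X i @^-1` B) (g w)%:E)%E.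
    move=> mB.
    have mXB : measurable (X i @^-1` B).
      by rewrite -(setTI (_ @^-1` _)); exact: measurable_funP.
    pose f' j := if j == i then \1_B else f j.
    pose e' j := if j == i then fine (P (X i @^-1` B)) else e j.
    have gE' w : \prod_(j in D) f' j (X j w) = \1_B (X i w) * g w.
      rewrite (bigD1 i)//= /f' eqxx; congr (_ * _).
      by apply: eq_bigr => j /andP[_ /negbTE ->].
    have ceE : \prod_(j in D) e' j = fine (P (X i @^-1` B)) * c.
      rewrite (bigD1 i)//= /e' eqxx; congr (_ * _).
      by apply: eq_bigr => j /andP[_ /negbTE ->].
    have := IH f' e'; rewrite ceE EFinM fineK ?fin_num_measure//.
    under eq_integral do rewrite gE'.
    rewrite /mscale/= muleC => <-; last first.
    + move=> j; rewrite /f' /e'; case: eqP => [->|_]; last exact: fe.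
      rewrite (integral_indic _ measurableT mXB) setIT fineK//.
      exact: fin_num_measure.
    + by move=> j x; rewrite /f'; case: eqP.
    + by move=> j; rewrite /f'; case: eqP.
    + move=> j jD js; rewrite /f'; have [ji|ji] := eqVneq j i.
        by exists B.
      by apply: fB; rewrite // inE negb_or ji.
    rewrite [RHS]integral_mkcond; apply: eq_integral => w _.
    rewrite patchE indicE.
    have -> : (X i w \in B) = (w \in X i @^-1` B).
      by apply/idP/idP => /set_mem ?; apply/mem_set.
    by case: ifP; rewrite ?mul1r ?mul0r.
  have mfi : measurable_fun [set: R] (EFin \o f i).
    by apply/measurable_EFinP; exact: mf.
  have := @ge0_integral_image_density _ _ T _ R P
    (mscale (NngNum c0) (distribution P (X i))) (X i) g (EFin \o f i)
    (@measurable_funPT _ _ _ _ (X i)) mg g0 nuE mfi _.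
  rewrite ge0_integral_mscale//; last by move=> x _; rewrite /= lee_fin.
  rewrite ge0_integral_distribution//; last by move=> x; rewrite /= lee_fin.
  rewrite /comp/= fe -EFinM => fgE.
  rewrite (bigD1 i)//= -/c mulrC fgE; last by move=> x; rewrite lee_fin.
  by apply: eq_integral => w _; rewrite (bigD1 i)//= EFinM.
Qed.

(** * Exponential moments of linear forms in Gaussian edge weights *)

(** Completing the square: tilting the density of mean [m] by [exp (c (y - m))]
    gives, up to a constant, the density of mean [m + c s^2]. *)
Lemma normal_mgf d (T : measurableType d) (R : realType)
    (P : probability T R) (X : {RV P >-> R}) (m s c : R) :
  s != 0 -> normally_distributed X m s ->
  (\int[P]_w (expR (c * (X w - m)))%:E = (expR (c ^+ 2 * s ^+ 2 / 2))%:E)%E.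
Proof.
move=> s0 nX.
have mexp : measurable_fun [set: R] (fun y => (expR (c * (y - m)))%:E).
  apply/measurable_EFinP/measurableT_comp => //.
  by apply: measurable_funM => //; exact: measurable_funB.
transitivity (\int[distribution P X]_y (expR (c * (y - m)))%:E)%E.
  by rewrite ge0_integral_distribution// => y; rewrite lee_fin expR_ge0.
rewrite (@ge0_integral_image_density _ _ _ _ R lebesgue_measure
  (distribution P X) id (normal_pdf m s)) //=; last 2 first.
- exact: measurable_normal_pdf.
- by move=> x; exact: normal_pdf_ge0.
transitivity (\int[lebesgue_measure]_x ((expR (c ^+ 2 * s ^+ 2 / 2))%:E *
    (normal_pdf (m + c * s ^+ 2) s x)%:E))%E.
  apply: eq_integral => x _; rewrite -!EFinM !normal_pdfE//.
  rewrite mulrCA [in RHS]mulrCA /normal_fun; congr (_ * _)%:E.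
  rewrite -!expRD; congr expR; rewrite -mulr_natr.
  by field; rewrite s0.
rewrite ge0_integralZl//; last 2 first.
- by apply/measurable_EFinP; exact: measurable_normal_pdf.
- by move=> x _; rewrite lee_fin normal_pdf_ge0.
by rewrite integral_normal_pdf mule1.
Qed.

Definition edge_form (R : realType) n (c : 'I_n * 'I_n -> R)
    (x : 'I_n -> 'I_n -> R) : R :=
  \sum_(p : 'I_n * 'I_n | (p.1 < p.2)%N) c p * x p.1 p.2.

Definition edge_dot (R : realType) n (c c' : 'I_n * 'I_n -> R) : R :=
  \sum_(p : 'I_n * 'I_n | (p.1 < p.2)%N) c p * c' p.

Lemma iid_normal_mgf d (T : measurableType d) (R : realType)
    (P : probability T R) n (Z : 'I_n -> 'I_n -> {RV P >-> R}) (m s : R)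
    (c : 'I_n * 'I_n -> R) :
  s != 0 -> iid_normal Z m s ->
  (\int[P]_w (expR (edge_form c (fun i j => Z i j w - m)))%:E
    = (expR (s ^+ 2 / 2 * edge_dot c c))%:E)%E.
Proof.
move=> s0 [indep nZ].
pose E := [set p : 'I_n * 'I_n | (p.1 < p.2)%N]%SET.
pose f (p : 'I_n * 'I_n) (y : R) := if p \in E then expR (c p * (y - m)) else 1.
pose e (p : 'I_n * 'I_n) := if p \in E then expR (c p ^+ 2 * s ^+ 2 / 2) else 1.
have := @independent_integral_prod _ _ _ P _ E _ f e indep.
have -> : \prod_(p in E) e p = expR (s ^+ 2 / 2 * edge_dot c c).
  rewrite /edge_dot mulr_sumr expR_sum; apply: eq_big => p; first by rewrite inE.
  by rewrite /e => ->; congr expR; rewrite expr2; ring.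
move=> <-.
- apply: eq_integral => w _; congr EFin.
  rewrite /edge_form expR_sum; apply: eq_big => p; first by rewrite inE.
  by move=> pE; rewrite /f inE pE.
- move=> p; rewrite /f; case: (p \in E) => //.
  apply: measurableT_comp => //.
  by apply: measurable_funM => //; exact: measurable_funB.
- by move=> p x; rewrite /f; case: ifP => // _; exact: expR_ge0.
- move=> p; rewrite /f /e; case: ifP => [|_]; last first.
    by rewrite integral_cst// mul1e; exact: probability_setT.
  by rewrite inE => /nZ nZp; exact: normal_mgf.
Qed.

(** Markov's inequality for combinations of exponentials, with coefficients of
    any sign.  After this lemma only deterministic inequalities are left for the
    event at hand. *)
Lemma prob_le_exp_sum d (T : measurableType d) (R : realType)
    (P : probability T R) n (Z : 'I_n -> 'I_n -> {RV P >-> R}) (m s : R)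
    (J : finType) (a : J -> R) (c : J -> 'I_n * 'I_n -> R) (B : set T) :
  s != 0 -> iid_normal Z m s -> measurable B ->
  (forall w, \1_B w <=
     \sum_j a j * expR (edge_form (c j) (fun i j => Z i j w - m))) ->
  (P B <= (\sum_j a j * expR (s ^+ 2 / 2 * edge_dot (c j) (c j)))%:E)%E.
Proof.
move=> s0 iid mB leB.
pose g j w := expR (edge_form (c j) (fun i j => Z i j w - m)).
have mg j : measurable_fun [set: T] (g j).
  apply: measurableT_comp => //; rewrite /edge_form.
  under eq_fun do rewrite -big_filter.
  apply: measurable_sum => p; apply: measurable_funM => //.
  exact: measurable_funB.
have ig j : P.-integrable [set: T] (EFin \o g j).
  apply/integrableP; split; first exact/measurable_EFinP.
  under eq_integral do rewrite /= ger0_norm ?expR_ge0//.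
  by rewrite (iid_normal_mgf _ s0 iid) ltry.
have -> : P B = (\int[P]_w (\1_B w)%:E)%E by rewrite integral_indic// setIT.
have -> : (\sum_j a j * expR (s ^+ 2 / 2 * edge_dot (c j) (c j)))%:E =
    (\int[P]_w (\sum_j a j * g j w)%:E)%E.
  rewrite -sumEFin; under [RHS]eq_integral do rewrite -sumEFin.
  rewrite integral_sum//; last first.
    move=> j; under eq_fun do rewrite EFinM.
    exact: (integrableZl measurableT (a j) (ig j)).
  apply: eq_bigr => j _; rewrite EFinM -(iid_normal_mgf _ s0 iid).
  under [RHS]eq_integral do rewrite EFinM.
  by rewrite (integralZl measurableT (ig j)).
apply: ge0_le_integral => //=.
- by apply/measurable_EFinP; exact: measurable_indic.
- apply/measurable_EFinP; apply: measurable_sum => j.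
  exact: measurable_funM.
- by move=> w _; rewrite lee_fin; exact: leB.
Qed.

Lemma edge_formZ (R : realType) n (t : R) (c : 'I_n * 'I_n -> R) x :
  edge_form (fun p => t * c p) x = t * edge_form c x.
Proof. by rewrite /edge_form mulr_sumr; apply: eq_bigr => p _; rewrite mulrA. Qed.

Lemma edge_formD (R : realType) n (c c' : 'I_n * 'I_n -> R) x :
  edge_form (fun p => c p + c' p) x = edge_form c x + edge_form c' x.
Proof. by rewrite /edge_form -big_split; apply: eq_bigr => p _; rewrite mulrDl. Qed.

Lemma edge_dotZZ (R : realType) n (t : R) (c : 'I_n * 'I_n -> R) :
  edge_dot (fun p => t * c p) (fun p => t * c p) = t ^+ 2 * edge_dot c c.
Proof. by rewrite /edge_dot mulr_sumr; apply: eq_bigr => p _; ring. Qed.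

Lemma edge_dotDD (R : realType) n (c c' : 'I_n * 'I_n -> R) :
  edge_dot (fun p => c p + c' p) (fun p => c p + c' p) =
  edge_dot c c + 2 * edge_dot c c' + edge_dot c' c'.
Proof.
rewrite /edge_dot mulr_sumr -!big_split; apply: eq_bigr => p _ /=; ring.
Qed.

Lemma union_bound_exp d (T : measurableType d) (R : realType)
    (P : probability T R) n (Z : 'I_n -> 'I_n -> {RV P >-> R}) (m s : R)
    (A : finType) (Q : pred A) (c : A -> 'I_n * 'I_n -> R) (t theta V : R)
    (B : set T) :
  s != 0 -> iid_normal Z m s -> 0 <= theta ->
  (forall a, Q a -> s ^+ 2 * edge_dot (c a) (c a) <= V) -> measurable B ->
  (forall w, B w ->
     exists2 a, Q a & t <= edge_form (c a) (fun i j => Z i j w - m)) ->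
  (P B <= (#|Q|%:R * expR (theta ^+ 2 * V / 2 - theta * t))%:E)%E.
Proof.
move=> s0 iid th0 cV mB BP.
pose wt a : R := if Q a then expR (- (theta * t)) else 0.
have := @prob_le_exp_sum _ _ _ P _ Z m s A wt (fun a p => theta * c a p) _
  s0 iid mB.
move=> /(_ _)/le_trans; apply.
- move=> w; rewrite indicE; have [/set_mem Bw|_] := boolP (w \in B); last first.
    apply: sumr_ge0 => a _; rewrite mulr_ge0 ?expR_ge0// /wt.
    by case: ifP => // _; exact: expR_ge0.
  have [a Qa ta] := BP w Bw.
  rewrite (bigD1 a)//= /wt Qa ler_wpDr//.
    apply: sumr_ge0 => b _; rewrite mulr_ge0 ?expR_ge0//.
    by case: ifP => // _; exact: expR_ge0.
  rewrite -expRD -expR0 ler_expR edge_formZ.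
  by rewrite addrC subr_ge0 ler_wpM2l.
- rewrite lee_fin -sum1_card natr_sum mulr_suml [leRHS]big_mkcond/=.
  apply: ler_sum => a _; rewrite /wt; case: ifPn => Qa.
    rewrite -topredE/= Qa mul1r -expRD ler_expR edge_dotZZ addrC lerD2r.
    have := cV _ Qa; have := sqr_ge0 theta; nra.
  by rewrite -topredE/= (negbTE Qa) mul0r.
Qed.

(** * The second moment of a truncated partition function *)

(** Let [X] be the sum of the [exp (beta y_a)] over the [a] with
    [l <= y_a <= u].  If all [y_a] are below [l] then [X = 0], so the indicator
    of this case is at most [(X / mu - 1)^2].  The square is expanded;
    [exp ((beta - theta) (2 u - y_a - y_b)) >= 1] replaces the upper truncation
    in [X^2], with a parameter [theta] that may depend on the pair, and the
    terms lost by truncating [X] are bounded by exponentials tilted further by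
    [lam]. *)
Lemma truncated_second_moment_pointwise (R : realType) (A : finType)
    (y : A -> R) (beta l u lam mu : R) (theta : A -> A -> R) :
  0 < mu -> 0 <= lam -> (forall a b, theta a b <= beta) ->
  (if [forall a, y a < l] then 1 else 0) <=
  mu ^- 2 * (\sum_a \sum_b
     expR (2 * (beta - theta a b) * u + theta a b * (y a + y b))) -
  2 / mu * (\sum_a (expR (beta * y a) - expR ((beta + lam) * y a - lam * u)
     - expR ((beta - lam) * y a + lam * l))) + 1.
Proof.
move=> mu0 lam0 theta_le.
pose t a : R := if l <= y a <= u then expR (beta * y a) else 0.
have t0 a : 0 <= t a by rewrite /t; case: ifP => // _; exact: expR_ge0.
set S2 := \sum_a \sum_b _; set S1 := \sum_a _; pose X := \sum_a t a.
have X0 : 0 <= X by apply: sumr_ge0.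
have leS1 : S1 <= X.
  apply: ler_sum => a _; rewrite /t.
  have e1 := expR_ge0 ((beta + lam) * y a - lam * u).
  have e2 := expR_ge0 ((beta - lam) * y a + lam * l).
  case: ifPn => [_|]; first by lra.
  rewrite negb_and -!ltNge => /orP[lty|lty].
  - suff : expR (beta * y a) <= expR ((beta - lam) * y a + lam * l) by lra.
    by rewrite ler_expR; nra.
  - suff : expR (beta * y a) <= expR ((beta + lam) * y a - lam * u) by lra.
    by rewrite ler_expR; nra.
have leS2 : X ^+ 2 <= S2.
  rewrite expr2 /X mulr_suml; apply: ler_sum => a _.
  rewrite mulr_sumr; apply: ler_sum => b _; rewrite /t.
  case: ifPn => [/andP[_ au]|_]; last by rewrite mul0r expR_ge0.
  case: ifPn => [/andP[_ bu]|_]; last by rewrite mulr0 expR_ge0.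
  rewrite -expRD ler_expR.
  by have := theta_le a b; nra.
have le_sq : (X / mu) ^+ 2 - 2 * (X / mu) + 1 <=
    mu ^- 2 * S2 - 2 / mu * S1 + 1.
  rewrite lerD2r lerB//.
    rewrite exprMn exprVn mulrC ler_wpM2l// invr_ge0; exact: exprn_ge0 (ltW mu0).
  by rewrite mulrAC mulrA ler_pM2r ?invr_gt0// ler_pM2l.
case: ifPn => [/forallP yl|_]; apply: le_trans le_sq.
  have -> : X = 0.
    rewrite /X big1// => a _; rewrite /t; case: ifP => // /andP[la _].
    by have := yl a; rewrite ltNge la.
  by rewrite mul0r; lra.
by have := sqr_ge0 (X / mu - 1); nra.
Qed.

(** The expectation of the pointwise bound, with [mu] the expectation of the
    partition function without truncation.  Under the measure tilted by
    [beta Y_a] the variable [Y_a] has mean [beta v] and variance [v]; leaving the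
    window of relative width [kap] around that mean costs
    [exp (- kap^2 beta^2 v / 2)] on each side. *)
Lemma truncated_second_moment d (T : measurableType d) (R : realType)
    (P : probability T R) n (Z : 'I_n -> 'I_n -> {RV P >-> R}) (m s : R)
    (A : finType) (c : A -> 'I_n * 'I_n -> R) (v beta kap u : R)
    (theta : A -> A -> R) (B : set T) :
  s != 0 -> iid_normal Z m s -> (0 < #|A|)%N ->
  (forall a, s ^+ 2 * edge_dot (c a) (c a) = v) ->
  0 <= v -> 0 <= beta -> 0 <= kap -> (1 + kap) * beta * v <= u ->
  (forall a b, theta a b <= beta) -> measurable B ->
  (forall w a, B w -> edge_form (c a) (fun i j => Z i j w - m) <
                       (1 - kap) * beta * v) ->
  (P B <= (4 * expR (- (kap ^+ 2 * beta ^+ 2 * v / 2)) - 1 + #|A|%:R ^- 2 *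
      \sum_a \sum_b expR (2 * (beta - theta a b) * u +
          theta a b ^+ 2 * (v + s ^+ 2 * edge_dot (c a) (c b))
          - beta ^+ 2 * v))%:E)%E.
Proof.
move=> s0 iid A0 cv v0 b0 k0 leu th mB BP.
set l := (1 - kap) * beta * v in BP.
pose mu := #|A|%:R * expR (beta ^+ 2 * v / 2) : R.
have cA0 : 0 < #|A|%:R :> R by rewrite ltr0n.
have mu0 : 0 < mu by rewrite mulr_gt0 ?expR_gt0.
pose J : finType := ((A * A) + (A + (A + (A + unit))))%type.
pose wt (j : J) : R := match j with
  | inl (a, b) => mu ^- 2 * expR (2 * (beta - theta a b) * u)
  | inr (inl _) => - (2 / mu)
  | inr (inr (inl _)) => 2 / mu * expR (- (kap * beta * u))
  | inr (inr (inr (inl _))) => 2 / mu * expR (kap * beta * l)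
  | inr (inr (inr (inr _))) => 1
  end.
pose cf (j : J) : 'I_n * 'I_n -> R := match j with
  | inl (a, b) => fun p => theta a b * (c a p + c b p)
  | inr (inl a) => fun p => beta * c a p
  | inr (inr (inl a)) => fun p => (beta + kap * beta) * c a p
  | inr (inr (inr (inl a))) => fun p => (beta - kap * beta) * c a p
  | inr (inr (inr (inr _))) => fun p => 0
  end.
have bigJ (F : J -> R) : \sum_j F j = \sum_a \sum_b F (inl (a, b)) +
    (\sum_a F (inr (inl a)) + (\sum_a F (inr (inr (inl a))) +
    (\sum_a F (inr (inr (inr (inl a)))) + F (inr (inr (inr (inr tt))))))).
  by rewrite !big_sumType/= pair_bigA/= (big_pred1 tt)//; congr (_ + _);
     apply: eq_bigr => -[].
have {mB} := @prob_le_exp_sum _ _ _ P _ Z m s J wt cf _ s0 iid mB.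
move=> /(_ _)/le_trans; apply.
- move=> w; set x := (fun i j => Z i j w - m).
  have := @truncated_second_moment_pointwise R A (fun a => edge_form (c a) x)
    beta l u (kap * beta) mu theta mu0 (mulr_ge0 k0 b0) th.
  set lhs := (if _ then 1 else 0); move=> lhs_le.
  have : \1_B w <= lhs.
    rewrite indicE; case: (boolP (w \in B)) => [/set_mem Bw|_] /=.
      rewrite /lhs; case: ifPn => // /negP[]; apply/forallP => a; exact: BP.
    by rewrite /lhs; case: ifP.
  move=> /le_trans; apply; apply: le_trans lhs_le _.
  rewrite bigJ /=.
  rewrite le_eqVlt; apply/orP; left; apply/eqP.
  rewrite -!addrA; congr (_ + _).
    rewrite mulr_sumr; apply: eq_bigr => a _.
    rewrite mulr_sumr; apply: eq_bigr => b _.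
    by rewrite -[RHS]mulrA -expRD edge_formZ edge_formD.
  rewrite !addrA; congr (_ + _); last first.
    by rewrite /edge_form big1 ?expR0 ?mulr1// => p _; rewrite mul0r.
  rewrite -mulNr mulr_sumr -!big_split; apply: eq_bigr => a _ /=.
  by rewrite !edge_formZ !expRD; ring.
- have dotE t a : s ^+ 2 / 2 * edge_dot (fun p => t * c a p) (fun p => t * c a p)
      = t ^+ 2 * v / 2.
    by rewrite edge_dotZZ -(cv a); ring.
  have muE t : #|A|%:R * (2 / mu * t) = 2 * (t * expR (- (beta ^+ 2 * v / 2))).
    rewrite /mu expRN; field.
    by rewrite gt_eqF ?expR_gt0// gt_eqF.
  rewrite lee_fin bigJ /= [leRHS]addrC; apply: lerD.
    rewrite mulr_sumr le_eqVlt; apply/orP; left; apply/eqP.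
    apply: eq_bigr => a _; rewrite mulr_sumr; apply: eq_bigr => b _.
    have -> : mu ^- 2 = #|A|%:R ^- 2 * expR (- (beta ^+ 2 * v)).
      rewrite expRN /mu exprMn [expR _ ^+ 2]expr2 -expRD invfM.
      by congr (_ * (expR _)^-1); lra.
    rewrite -!mulrA -!expRD edge_dotZZ edge_dotDD.
    congr (_ * expR _); rewrite -{1}(cv a).
    have := cv b; rewrite -(cv a) => /(mulfI (expf_neq0 2 s0)) ->.
    by field.
  have sumE (F : A -> R) t : (forall a, F a = 2 / mu * t) ->
      \sum_a F a = 2 * (t * expR (- (beta ^+ 2 * v / 2))).
    move=> FE; rewrite (eq_bigr _ (fun a _ => FE a)) -muE.
    by rewrite sumr_const -[LHS]mulr_natl.
  rewrite (sumE _ (- expR (beta ^+ 2 * v / 2))); last first.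
    by move=> a; rewrite dotE; lra.
  rewrite (sumE _ (expR (- (kap * beta * u)) *
                   expR ((beta + kap * beta) ^+ 2 * v / 2))); last first.
    by move=> a; rewrite dotE; ring.
  rewrite (sumE _ (expR (kap * beta * l) *
                   expR ((beta - kap * beta) ^+ 2 * v / 2))); last first.
    by move=> a; rewrite dotE; ring.
  rewrite mulNr -!expRD.
  have -> : edge_dot (fun _ : 'I_n * 'I_n => 0 : R) (fun _ => 0) = 0.
    by rewrite /edge_dot big1// => p _; rewrite mul0r.
  rewrite mulr0 expR0 subrr expR0.
  have -> : kap * beta * l + (beta - kap * beta) ^+ 2 * v / 2 -
      beta ^+ 2 * v / 2 = - (kap ^+ 2 * beta ^+ 2 * v / 2).
    by rewrite /l; field.
  have : expR (- (kap * beta * u) + (beta + kap * beta) ^+ 2 * v / 2 -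
      beta ^+ 2 * v / 2) <= expR (- (kap ^+ 2 * beta ^+ 2 * v / 2)).
    by rewrite ler_expR; have := mulr_ge0 k0 b0; nra.
  by lra.
Qed.

(** * Weights of vertex sets as linear forms *)

Lemma sum_lt_prod (R : realType) n (f : 'I_n -> R) :
  \sum_(p : 'I_n * 'I_n | (p.1 < p.2)%N) f p.1 * f p.2 =
  ((\sum_i f i) ^+ 2 - \sum_i f i ^+ 2) / 2.
Proof.
have -> : (\sum_i f i) ^+ 2 =
    \sum_(p : 'I_n * 'I_n | (p.1 < p.2)%N) f p.1 * f p.2 +
    (\sum_(p : 'I_n * 'I_n | ~~ (p.1 < p.2)%N && (p.2 < p.1)%N) f p.1 * f p.2 +
     \sum_(p : 'I_n * 'I_n | ~~ (p.1 < p.2)%N && ~~ (p.2 < p.1)%N)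
        f p.1 * f p.2).
  rewrite expr2 big_distrlr /= pair_bigA/=.
  rewrite (bigID (fun p : 'I_n * 'I_n => (p.1 < p.2)%N))/=; congr (_ + _).
  by rewrite (bigID (fun p : 'I_n * 'I_n => (p.2 < p.1)%N)).
have -> : \sum_(p : 'I_n * 'I_n | ~~ (p.1 < p.2)%N && (p.2 < p.1)%N)
    f p.1 * f p.2 = \sum_(p : 'I_n * 'I_n | (p.1 < p.2)%N) f p.1 * f p.2.
  rewrite (reindex_inj (h := fun p : 'I_n * 'I_n => (p.2, p.1))) /=; last first.
    by move=> [a b] [a' b'] [-> ->].
  apply: eq_big => [[a b]|[a b] _] /=; last by rewrite mulrC.
  by case: ltngtP.
have -> : \sum_(p : 'I_n * 'I_n | ~~ (p.1 < p.2)%N && ~~ (p.2 < p.1)%N)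
    f p.1 * f p.2 = \sum_i f i ^+ 2.
  rewrite (reindex_onto (fun i : 'I_n => (i, i)) fst) /=; last first.
    by move=> [a b] /=; case: ltngtP => // /val_inj ->.
  by apply: eq_big => [i|i _]; rewrite ?ltnn ?eqxx// expr2.
by lra.
Qed.

Definition pair_prod (R : realType) n (f : 'I_n -> R) (p : 'I_n * 'I_n) : R :=
  f p.1 * f p.2.

Definition indicator_of (R : realType) n (S : {set 'I_n}) (u : 'I_n) : R :=
  (u \in S)%:R.
Arguments indicator_of R {n} S u.

Lemma edge_dot_pair_prod (R : realType) n (f g : 'I_n -> R) :
  edge_dot (pair_prod f) (pair_prod g) =
  ((\sum_i f i * g i) ^+ 2 - \sum_i (f i * g i) ^+ 2) / 2.
Proof.
rewrite -(sum_lt_prod (fun i => f i * g i)).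
by apply: eq_bigr => p _; rewrite /pair_prod; ring.
Qed.

Lemma sum_indicator (R : realType) n (S : {set 'I_n}) :
  \sum_i indicator_of R S i = #|S|%:R.
Proof. by rewrite -sum1_card natr_sum [RHS]big_mkcond; apply: eq_bigr => i _;
  rewrite /indicator_of; case: (i \in S). Qed.

Lemma indicator_sqr (R : realType) n (S : {set 'I_n}) i :
  indicator_of R S i ^+ 2 = indicator_of R S i.
Proof. by rewrite /indicator_of; case: (i \in S); rewrite ?expr1n ?expr0n. Qed.

Lemma subset_weightE (R : realType) n (z : 'I_n -> 'I_n -> R) (m : R)
    (S : {set 'I_n}) :
  subset_weight z S =
  m * (#|S|%:R ^+ 2 - #|S|%:R) / 2 +
  edge_form (pair_prod (indicator_of R S)) (fun i j => z i j - m).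
Proof.
have -> : subset_weight z S = \sum_(p : 'I_n * 'I_n | (p.1 < p.2)%N)
    pair_prod (indicator_of R S) p * z p.1 p.2.
  rewrite /subset_weight pair_big_dep/= big_mkcond [RHS]big_mkcond/=.
  apply: eq_bigr => -[i j] _ /=; rewrite /pair_prod /indicator_of /=.
  by case: (i \in S); case: (j \in S); case: ltnP => //= _;
     rewrite ?(mul0r, mulr0, mul1r).
have -> : #|S|%:R ^+ 2 - #|S|%:R =
    (\sum_i indicator_of R S i) ^+ 2 - \sum_i indicator_of R S i ^+ 2.
  rewrite -sum_indicator; congr (_ - _).
  by apply: eq_bigr => i _; rewrite indicator_sqr.
rewrite -mulrA -sum_lt_prod mulr_sumr -big_split; apply: eq_bigr => p _ /=.
by rewrite /pair_prod; ring.
Qed.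

Lemma edge_dot_indicator (R : realType) n (S : {set 'I_n}) :
  edge_dot (pair_prod (indicator_of R S)) (pair_prod (indicator_of R S)) =
  (#|S|%:R ^+ 2 - #|S|%:R) / 2.
Proof.
rewrite edge_dot_pair_prod -sum_indicator; congr ((_ ^+ 2 - _) / 2);
  by apply: eq_bigr => i _; rewrite -expr2 !indicator_sqr.
Qed.

(** * Transversals of a family of blocks *)

Definition transversal n k m (emb : 'I_k * 'I_m -> 'I_n)
    (a : {ffun 'I_k -> 'I_m}) : {set 'I_n} :=
  [set emb (i, a i) | i in 'I_k]%SET.

Definition agree k m (a b : {ffun 'I_k -> 'I_m}) : nat :=
  #|[set i | a i == b i]%SET|.

(** On the blocks, the indicator of the transversal minus its average over a
    block; zero on the vertices outside the blocks. *)
Definition centered (R : realType) n k m (emb : 'I_k * 'I_m -> 'I_n)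
    (a : {ffun 'I_k -> 'I_m}) (u : 'I_n) : R :=
  indicator_of R (transversal emb a) u -
  indicator_of R (emb @: [set: 'I_k * 'I_m])%SET u / m%:R.
Arguments centered R {n k m} emb a u.

(** The common value of [edge_dot] on the diagonal ([edge_dot_centered]); the
    second term is the sum of the fourth powers of the entries of a centered
    transversal. *)
Definition centered_norm (R : realType) (k m : nat) : R :=
  ((k%:R - k%:R / m%:R) ^+ 2 -
   (k%:R * ((1 - m%:R^-1) ^+ 4 - m%:R ^- 4) + k%:R * m%:R * m%:R ^- 4)) / 2.

Section blocks.
Variables (R : realType) (n k m : nat) (emb : 'I_k * 'I_m -> 'I_n).
Hypothesis emb_inj : injective emb.
Hypothesis m_gt0 : (0 < m)%N.
Implicit Types a b : {ffun 'I_k -> 'I_m}.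

Let V0 : {set 'I_n} := (emb @: [set: 'I_k * 'I_m])%SET.
Let h a := indicator_of R (transversal emb a).
Let e := indicator_of R V0.
Let q a := centered R emb a.
Let mR : R := m%:R.

Let mR0 : mR != 0. Proof. by rewrite pnatr_eq0 -lt0n. Qed.

Lemma card_transversal a : #|transversal emb a| = k.
Proof. by rewrite card_imset ?card_ord// => i j /emb_inj[]. Qed.

Let cardV0 : #|V0| = (k * m)%N.
Proof. by rewrite card_imset// cardsT card_prod !card_ord. Qed.

Let he a u : h a u * e u = h a u.
Proof.
rewrite /h /e /indicator_of; case: (boolP (u \in transversal _ _)).
  by move=> /imsetP[i _ ->]; rewrite imset_f ?inE// mulr1.
by rewrite mul0r.
Qed.

Let ee u : e u * e u = e u. Proof. by rewrite -expr2 indicator_sqr. Qed.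

Let sum_e : \sum_u e u = k%:R * mR.
Proof. by rewrite sum_indicator cardV0 natrM. Qed.

Let sum_h a : \sum_u h a u = k%:R.
Proof. by rewrite sum_indicator card_transversal. Qed.

Let sum_hh a b : \sum_u h a u * h b u = (agree a b)%:R.
Proof.
have -> : agree a b = #|transversal emb a :&: transversal emb b|.
  rewrite /agree -(card_imset _ (f := fun i => emb (i, a i))); last first.
    by move=> i j /emb_inj[].
  congr #|pred_of_set _|; apply/setP => u; rewrite !inE.
  apply/imsetP/andP => [[i]|[/imsetP[i _ ->] /imsetP[j _ /emb_inj[ij aij]]]].
    rewrite inE => /eqP ab ->; split; first exact: imset_f.
    by rewrite ab; exact: imset_f.
  by exists i => //; rewrite inE aij ij.
rewrite -sum_indicator; apply: eq_bigr => u _.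
rewrite /h /indicator_of inE.
by case: (u \in _); case: (u \in _); rewrite ?(mul0r, mulr0, mulr1).
Qed.

Let agree_self a : agree a a = k.
Proof.
rewrite /agree -[RHS]card_ord -cardsT.
by apply: eq_card => i; rewrite !inE eqxx.
Qed.

Lemma sum_centered a b :
  \sum_u q a u * q b u = (agree a b)%:R - k%:R / mR.
Proof.
have qq u : q a u * q b u =
    h a u * h b u + (h a u + h b u) * - mR^-1 + e u * (mR^-1 * mR^-1).
  transitivity (h a u * h b u - (h a u * e u + h b u * e u) * mR^-1 +
      e u * e u * (mR^-1 * mR^-1)); first by rewrite /q /centered; ring.
  by rewrite !he ee mulrN.
under eq_bigr do rewrite qq.
rewrite !big_split/= -!mulr_suml big_split/= sum_hh !sum_h sum_e.
by field.
Qed.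

Lemma edge_dot_centered a :
  edge_dot (pair_prod (q a)) (pair_prod (q a)) = centered_norm R k m.
Proof.
rewrite edge_dot_pair_prod sum_centered agree_self.
congr ((_ - _) / 2).
have q4 u : (q a u * q a u) ^+ 2 =
    h a u * ((1 - mR^-1) ^+ 4 - mR ^- 4) + e u * mR ^- 4.
  have := he a u; rewrite /q /centered -/(h a u) -/(e u) /h /e /indicator_of.
  by case: (u \in _); case: (u \in _) => /= heE; try lra; rewrite -exprVn; field.
under eq_bigr do rewrite q4.
by rewrite big_split/= -!mulr_suml sum_h sum_e.
Qed.

Lemma centered_norm_bounds :
  ((k%:R - k%:R / mR) ^+ 2 - k%:R) / 2 <= centered_norm R k m <= k%:R ^+ 2 / 2.
Proof.
have k0 : 0 <= k%:R :> R by [].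
have [t [tE t0 t1]] : exists t : R, [/\ mR^-1 = t, 0 <= t & t <= 1].
  by exists mR^-1; rewrite invr_ge0 ler0n invf_le1 ?ler1n ?ltr0n.
have -> : centered_norm R k m =
    ((k%:R - k%:R * t) ^+ 2 - k%:R * ((1 - t) ^+ 4 + t ^+ 3 * (1 - t))) / 2.
  by rewrite /centered_norm -!exprVn -/mR !tE -tE; field.
rewrite tE; set K : R := k%:R in k0 *.
have t3 : t ^+ 3 <= 1 by rewrite exprn_ile1.
have t4 : (1 - t) ^+ 3 <= 1 by rewrite exprn_ile1; lra.
have t3' : 0 <= t ^+ 3 by rewrite exprn_ge0.
have t4' : 0 <= (1 - t) ^+ 3 by rewrite exprn_ge0; lra.
have W0 : 0 <= (1 - t) ^+ 4 + t ^+ 3 * (1 - t) <= 1.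
  have -> : (1 - t) ^+ 4 = (1 - t) ^+ 3 * (1 - t) by rewrite -exprSr.
  have t33 : t ^+ 3 <= t.
    by rewrite exprS ler_piMr// exprn_ile1.
  apply/andP; split; first by rewrite addr_ge0// mulr_ge0//; lra.
  by nra.
case/andP: W0 => W0 W1.
have KW0 := mulr_ge0 k0 W0.
have KW1 : K * ((1 - t) ^+ 4 + t ^+ 3 * (1 - t)) <= K by rewrite ler_piMr.
have Kt : (K - K * t) ^+ 2 <= K ^+ 2.
  have := mulr_ge0 k0 t0; have := ler_piMr k0 t1 => Kt1 Kt0.
  by rewrite ler_sqr ?nnegrE; lra.
by apply/andP; split; lra.
Qed.

(** The point of the centering: without it the bound would have [agree a b] in
    place of its deviation from the mean [k / m]. *)
Lemma edge_dot_centered_le a b :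
  edge_dot (pair_prod (q a)) (pair_prod (q b)) <=
  ((agree a b)%:R - k%:R / mR) ^+ 2 / 2.
Proof.
rewrite edge_dot_pair_prod sum_centered ler_pM2r ?invr_gt0//.
by rewrite gerBl; apply: sumr_ge0 => u _; exact: sqr_ge0.
Qed.

(** Over all ordered pairs of vertices the squared norm of [h h - q q] is
    [|h|^4 - 2 <h, q>^2 + |q|^4], and [<h, q> = |q|^2 = k - k / m] because [q] is
    the projection of [h] orthogonal to the indicators of the blocks. *)
Lemma edge_dot_residual a :
  edge_dot (fun p => pair_prod (h a) p - pair_prod (q a) p)
           (fun p => pair_prod (h a) p - pair_prod (q a) p)
  <= 2 * k%:R ^+ 2 / mR.
Proof.
pose r (p : 'I_n * 'I_n) := pair_prod (h a) p - pair_prod (q a) p.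
have sum_hq : \sum_u h a u * q a u = k%:R - k%:R / mR.
  transitivity (\sum_u h a u * (1 - mR^-1)); last first.
    by rewrite -mulr_suml sum_h; ring.
  apply: eq_bigr => u _.
  transitivity (h a u ^+ 2 - (h a u * e u) / mR).
    by rewrite /q /centered; ring.
  by rewrite he indicator_sqr; ring.
have sum_sqr (f g : 'I_n -> R) :
    \sum_(p : 'I_n * 'I_n) pair_prod f p * pair_prod g p =
    (\sum_u f u * g u) ^+ 2.
  rewrite expr2 big_distrlr pair_bigA; apply: eq_bigr => p _ /=.
  by rewrite /pair_prod; ring.
apply: (@le_trans _ _ (\sum_(p : 'I_n * 'I_n) r p * r p)).
  rewrite [leRHS](bigID (fun p : 'I_n * 'I_n => (p.1 < p.2)%N))/=.
  by rewrite lerDl; apply: sumr_ge0 => p _; rewrite -expr2 sqr_ge0.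
have -> : \sum_(p : 'I_n * 'I_n) r p * r p =
    (\sum_u h a u * h a u) ^+ 2 + (\sum_u h a u * q a u) ^+ 2 * -2 +
    (\sum_u q a u * q a u) ^+ 2.
  rewrite -!sum_sqr mulr_suml -!big_split; apply: eq_bigr => p _ /=.
  by rewrite /r; ring.
rewrite sum_hh sum_hq sum_centered agree_self.
have -> : k%:R ^+ 2 + (k%:R - k%:R / mR) ^+ 2 * -2 + (k%:R - k%:R / mR) ^+ 2 =
    2 * k%:R ^+ 2 / mR - (k%:R / mR) ^+ 2 by field.
by rewrite gerBl sqr_ge0.
Qed.

(** For a uniform [b] the events [a i = b i] are independent of probability
    [1 / m]. *)
Lemma sum_exp_agree (s : R) a :
  \sum_b expR (s * (agree a b)%:R) = (expR s + (m%:R - 1)) ^+ k.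
Proof.
have -> : (expR s + (m%:R - 1)) ^+ k =
    \prod_(i < k) \sum_(j < m) (if a i == j then expR s else 1).
  rewrite (eq_bigr (fun=> expR s + (m%:R - 1))); last first.
    move=> i _; rewrite (bigD1 (a i))//= eqxx; congr (_ + _).
    rewrite (eq_bigr (fun=> 1)); last by move=> j /negbTE; rewrite eq_sym => ->.
    rewrite sumr_const cardC1 card_ord -subn1 natrB//.
  by rewrite prodr_const card_ord.
rewrite bigA_distr_bigA/=; apply: eq_bigr => b _.
rewrite -big_mkcond/= prodr_const /agree cardsE -expRM_natl.
by congr expR; rewrite mulrC.
Qed.

End blocks.

(** * The exponent as a function of the overlap *)

(** For each value [j] of the overlap, either the exponent is small, or a
    Chernoff bound for the number of agreements pays for it.  Treating the values
    separately costs only the factor [k + 1]. *)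
Lemma sum_exp_fun_agree (R : realType) k m (a : {ffun 'I_k -> 'I_m})
    (Phi : nat -> R) (h0 T : R) :
  (0 < m)%N ->
  (forall j, (j <= k)%N -> Phi j <= h0 \/
     exists s, Phi j + T <= s * j%:R - k%:R / m%:R * (expR s - 1)) ->
  \sum_b expR (Phi (agree a b)) <=
    m%:R ^+ k * (expR h0 + k.+1%:R * expR (- T)).
Proof.
move=> m0 PhiP.
have mR0 : 0 < m%:R :> R by rewrite ltr0n.
have [s sP] : {s : nat -> R & forall j, (j <= k)%N -> Phi j <= h0 \/
     Phi j + T <= s j * j%:R - k%:R / m%:R * (expR (s j) - 1)}.
  apply: (@boolp.choice _ _ (fun j s => (j <= k)%N -> Phi j <= h0 \/
    Phi j + T <= s * j%:R - k%:R / m%:R * (expR s - 1))) => j.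
  have [jk|jk] := boolP (j <= k)%N; last by exists 0.
  by case: (PhiP j jk) => [|[s ?]]; [exists 0; left|exists s; right].
pose G (j : nat) b := expR (- T - k%:R / m%:R * (expR (s j) - 1)) *
  expR (s j * (agree a b)%:R).
have le_pt b : expR (Phi (agree a b)) <= expR h0 + \sum_(j < k.+1) G j b.
  have agk : (agree a b <= k)%N.
    by rewrite /agree -[leqRHS]card_ord; exact: max_card.
  have G0 (j : 'I_k.+1) : 0 <= G j b by rewrite mulr_ge0 ?expR_ge0.
  have [le_h|le_s] := sP _ agk.
    by rewrite ler_wpDr ?sumr_ge0// ler_expR.
  rewrite ler_wpDl ?expR_ge0//.
  have ltk : (agree a b < k.+1)%N by [].
  rewrite (bigD1 (Ordinal ltk))//= ler_wpDr ?sumr_ge0//.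
  by rewrite /G -expRD ler_expR; lra.
apply: le_trans (ler_sum _ (fun b _ => le_pt b)) _.
rewrite big_split/= mulrDr; apply: lerD.
  by rewrite sumr_const card_ffun !card_ord -[leLHS]mulr_natl natrX.
rewrite exchange_big/= mulrCA.
have -> : k.+1%:R * (m%:R ^+ k * expR (- T)) =
    \sum_(j < k.+1) m%:R ^+ k * expR (- T) :> R.
  by rewrite sumr_const card_ord -[RHS]mulr_natl.
apply: ler_sum => j _; rewrite /G -mulr_sumr sum_exp_agree//.
set x := expR (s j) - 1.
have -> : expR (s j) + (m%:R - 1) = m%:R * (1 + x / m%:R).
  by rewrite /x; field; rewrite gt_eqF.
have le_x : 1 + x / m%:R <= expR (x / m%:R) by exact: expR_ge1Dx.
have x0 : 0 <= 1 + x / m%:R.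
  rewrite -(@pmulr_lge0 _ m%:R)// mulrDl mul1r divfK ?gt_eqF//.
  rewrite /x addrCA addrA -addrA addr_ge0 ?expR_ge0// subr_ge0.
  by rewrite ler1n.
rewrite exprMn mulrCA ler_wpM2l ?(exprn_ge0 _ (ltW mR0))//.
have : (1 + x / m%:R) ^+ k <= expR (x / m%:R) ^+ k.
  by rewrite lerXn2r ?nnegrE ?expR_ge0.
rewrite -expRM_natl => le_xk.
apply: le_trans (ler_wpM2l (expR_ge0 _) le_xk) _.
rewrite -expRD ler_expR.
by rewrite mulrA [_ * x]mulrC; lra.
Qed.

Lemma expR_le_quadratic (R : realType) (s : R) :
  s <= 1 / 2 -> expR s <= 1 + s + 2 * s ^+ 2.
Proof.
move=> s2; have lt1 : 0 < 1 - s by lra.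
have : 1 - s <= expR (- s) by have := expR_ge1Dx (- s).
rewrite expRN => le_inv.
have : expR s <= (1 - s)^-1.
  by rewrite -[leLHS]invrK lef_pV2// posrE ?invr_gt0 ?expR_gt0.
move=> /le_trans; apply.
rewrite -[leLHS]mul1r ler_pdivrMr//.
have -> : (1 + s + 2 * s ^+ 2) * (1 - s) = 1 + s ^+ 2 * (1 - 2 * s) by ring.
by rewrite lerDl mulr_ge0 ?sqr_ge0//; lra.
Qed.

(** Without truncation the exponent is at most [2 L (J - K/M)^2 / K].  The
    Chernoff parameter [s] is proportional to the deviation near the mean [K/M],
    as for a Gaussian, constant for larger overlaps up to [K / (16 L)], and
    [L / 2] beyond. *)
Lemma low_overlap_exponent (R : realType) (K M L T h0 J : R) :
  0 < K -> 0 < L -> 0 <= T -> 0 <= h0 -> 0 <= J -> 8 * J <= K ->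
  expR L = M -> 40 * L <= M -> 40 * (L * T) <= h0 * M ->
  128 * (L * T ^+ 2) <= h0 * K -> 128 * T <= K -> expR (- (L / 2)) <= 1 / 128 ->
  let Phi := 2 * L * (J - K / M) ^+ 2 / K in
  Phi <= h0 \/ exists s, Phi + T <= s * J - K / M * (expR s - 1).
Proof.
move=> K0 L0 T0 h00 J0 JK eL LM LTM LTK TK eL2 Phi.
have M0 : 0 < M by rewrite -eL expR_gt0.
have [small|large] := leP Phi h0; [by left|right].
set D := J - K / M in Phi large *.
have DD : h0 * K < 2 * L * D ^+ 2 by rewrite -ltr_pdivlMr.
have [J4|J4] := leP J (4 * (K / M)).
  (* Maximizing s D - 2 s^2 K / M would give D M / (4 K); the smaller
     denominator keeps s below 1/2. *)
  exists (D * M / (6 * K)).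
  have KM0 : 0 < K / M by rewrite divr_gt0.
  have s2 : D * M / (6 * K) <= 1 / 2.
    rewrite ler_pdivrMr; last by lra.
    have : D <= 3 * (K / M) by rewrite /D; lra.
    by move=> /(ler_wpM2r (ltW M0)); rewrite -mulrA divfK ?gt_eqF//; lra.
  have := expR_le_quadratic s2; set s := D * M / _ => e_le.
  have : K / M * (expR s - 1) <= K / M * (s + 2 * s ^+ 2).
    by rewrite ler_wpM2l ?(ltW KM0)//; lra.
  suff : Phi + T <= s * J - K / M * (s + 2 * s ^+ 2) by lra.
  have -> : s * J - K / M * (s + 2 * s ^+ 2) = D ^+ 2 * M / (9 * K).
    have -> : J = D + K / M by rewrite /D; ring.
    by rewrite /s; field; rewrite !gt_eqF.
  have T_le : T <= D ^+ 2 * M / (20 * K).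
    rewrite ler_pdivlMr; last by lra.
    rewrite -(ler_pM2l L0).
    have : h0 * M * K <= 2 * L * D ^+ 2 * M.
      by rewrite mulrAC ler_wpM2r ?(ltW M0)// ltW.
    have : 40 * (L * T) * K <= h0 * M * K by rewrite ler_wpM2r ?(ltW K0).
    lra.
  have P_le : Phi <= D ^+ 2 * M / (20 * K).
    rewrite /Phi ler_pdivrMr//.
    have -> : D ^+ 2 * M / (20 * K) * K = D ^+ 2 * (M / 20).
      by field; rewrite gt_eqF.
    by rewrite mulrC ler_wpM2l ?sqr_ge0//; lra.
  have -> : D ^+ 2 * M / (9 * K) = D ^+ 2 * M / (20 * K) * (20 / 9).
    by field; rewrite gt_eqF.
  by lra.
have KM0 : 0 < K / M by rewrite divr_gt0.
have D0 : 0 <= D by rewrite /D; lra.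
have DJ : D <= J by rewrite /D; lra.
have D2 : D ^+ 2 <= J ^+ 2 by rewrite ler_sqr ?nnegrE.
have PhiJ : Phi <= 2 * L * J ^+ 2 / K.
  by rewrite ler_pM2r ?invr_gt0// ler_pM2l// mulr_gt0.
have [J16|J16] := leP (16 * (L * J)) K.
  exists (1 / 2).
  have s2 : (1 / 2 : R) <= 1 / 2 by [].
  have := expR_le_quadratic s2 => e_le.
  have : K / M * (expR (1 / 2) - 1) <= K / M * 1.
    by rewrite ler_wpM2l ?(ltW KM0)//; lra.
  have : 2 * L * J ^+ 2 / K <= J / 8.
    by rewrite ler_pdivrMr//; have := ler_wpM2l J0 J16; lra.
  have : T <= J / 8.
    suff : (8 * T) ^+ 2 <= J ^+ 2 by rewrite ler_sqr ?nnegrE; lra.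
    rewrite -(ler_pM2l L0).
    have := ler_wpM2l (ltW L0) D2; lra.
  lra.
exists (L / 2).
have : K / M * (expR (L / 2) - 1) <= K / 128.
  have -> : K / M * (expR (L / 2) - 1) = K * (expR (- (L / 2)) - M^-1).
    rewrite -eL -expRN; have -> : - L = - (L / 2) - L / 2 by lra.
    rewrite expRD [expR (L / 2)](_ : _ = (expR (- (L / 2)))^-1).
      by field; rewrite gt_eqF ?expR_gt0.
    by rewrite expRN invrK.
  rewrite ler_pM2l//.
  have : 0 < M^-1 by rewrite invr_gt0.
  lra.
have : 2 * L * J ^+ 2 / K <= L * J / 4.
  rewrite ler_pdivrMr//; have := ler_wpM2l (mulr_ge0 (ltW L0) J0) JK; lra.
lra.
Qed.

(** Here [rho = J / K].  The choice of [theta] minimizes the left-hand side up to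
    the relative width [kap] of the window, and gives the exponent
    [beta^2 K^2 / 8 * rho^2 / (1 + rho^2)]; this is where
    [2 rho^2 / (1 + rho^2) <= rho] is used.  At criticality this is an equality
    at [rho = 1], and taking [beta] below the critical value by the factor
    [1 - kap] leaves the margin [kap^2 L J]. *)
Lemma high_overlap_exponent (R : realType) (K M L T kap J beta theta u v V : R) :
  0 < K -> 0 < L -> 0 <= T -> 0 < kap <= 1 -> 0 <= beta -> 0 <= J <= K ->
  K < 8 * J -> 16 <= M -> expR L = M ->
  beta ^+ 2 * K = 16 * (1 - kap) ^+ 2 * L ->
  u = (1 + kap) * beta * (K ^+ 2 / 8) ->
  ((K - K / M) ^+ 2 - K) / 8 <= v <= K ^+ 2 / 8 ->
  V <= (J - K / M) ^+ 2 / 8 ->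
  K + 4 * L * K / M + 2 * L + T <= kap ^+ 2 * K * L / 8 ->
  theta = beta / (1 + (J / K) ^+ 2) ->
  2 * (beta - theta) * u + theta ^+ 2 * (v + V) - beta ^+ 2 * v + T
    <= L * J - K / M * (expR L - 1).
Proof.
move=> K0 L0 T0 /andP[kap0 kap1] b0 /andP[J0 JK] KJ M16 eL bK uE.
move=> /andP[vlo vhi] VJ big thE.
have M0 : 0 < M by lra.
have KM0 : 0 < K / M by rewrite divr_gt0.
set rho := J / K.
have rho0 : 0 <= rho by rewrite divr_ge0// ltW.
pose w := K ^+ 2 / 8.
have bw : beta ^+ 2 * w = 2 * (1 - kap) ^+ 2 * K * L.
  by rewrite /w; have := congr1 (fun x => x * K / 8) bK => /=; lra.
have JE : J = rho * K by rewrite /rho divfK// gt_eqF.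
have KMJ : K / M <= J.
  suff : K / M <= K / 16 by lra.
  by rewrite ler_pM2l// lef_pV2 ?posrE//.
have V_le : V <= w * rho ^+ 2.
  apply: le_trans VJ _.
  have -> : w * rho ^+ 2 = J ^+ 2 / 8 by rewrite JE /w; ring.
  by rewrite ler_pM2r// ler_sqr ?nnegrE; lra.
have r1 : 0 < 1 + rho ^+ 2 by rewrite ltr_wpDr// sqr_ge0.
have th2 : theta ^+ 2 * (v + V) <= theta ^+ 2 * (w * (1 + rho ^+ 2)).
  by rewrite ler_wpM2l ?sqr_ge0//; rewrite /w in V_le *; lra.
have mainE : 2 * (beta - theta) * u + theta ^+ 2 * (w * (1 + rho ^+ 2)) =
    beta ^+ 2 * w + beta ^+ 2 * w * (1 + 2 * kap) * (rho ^+ 2 / (1 + rho ^+ 2)).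
  by rewrite uE thE -/rho -/w; field; rewrite gt_eqF.
have rho_le : rho ^+ 2 / (1 + rho ^+ 2) <= rho / 2.
  rewrite ler_pdivrMr//.
  by have := mulr_ge0 rho0 (sqr_ge0 (1 - rho)); lra.
have main_le : beta ^+ 2 * w * (1 + 2 * kap) * (rho ^+ 2 / (1 + rho ^+ 2)) <=
    (1 - kap ^+ 2) * L * J.
  have : beta ^+ 2 * w * (1 + 2 * kap) * (rho ^+ 2 / (1 + rho ^+ 2)) <=
      beta ^+ 2 * w * (1 + 2 * kap) * (rho / 2).
    rewrite ler_wpM2l// mulr_ge0//; last by lra.
    by rewrite mulr_ge0 ?sqr_ge0// /w divr_ge0// sqr_ge0.
  move=> /le_trans; apply.
  have -> : beta ^+ 2 * w * (1 + 2 * kap) * (rho / 2) =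
      ((1 - kap) ^+ 2 * (1 + 2 * kap)) * L * J.
    by rewrite bw JE; field.
  rewrite ler_wpM2r// ler_wpM2r ?(ltW L0)//.
  have := mulr_ge0 (sqr_ge0 kap) (_ : 0 <= 1 - kap); rewrite subr_ge0 => /(_ kap1).
  lra.
have bwv : beta ^+ 2 * (w - v) <= 4 * L * K / M + 2 * L.
  have : beta ^+ 2 * (w - v) <= beta ^+ 2 * ((2 * K / M + 1) * K / 8).
    rewrite ler_wpM2l ?sqr_ge0//.
    have -> : (2 * K / M + 1) * K / 8 = (2 * (K / M) * K + K) / 8 by ring.
    have := sqr_ge0 (K / M); rewrite /w; lra.
  move=> /le_trans; apply.
  have -> : beta ^+ 2 * ((2 * K / M + 1) * K / 8) =
     2 * (1 - kap) ^+ 2 * (L * (2 * K / M + 1)).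
    by have := congr1 (fun x => x * (2 * K / M + 1) / 8) bK => /=; lra.
  have -> : 4 * L * K / M + 2 * L = 2 * (L * (2 * K / M + 1)) by ring.
  rewrite -mulrA ler_pM2l// ler_piMl ?mulr_ge0 ?(ltW L0)//.
    by have := ltW KM0; rewrite -mulrA; lra.
  by rewrite exprn_ile1//; lra.
have -> : L * J - K / M * (expR L - 1) = L * J - K + K / M.
  by rewrite eL; field; rewrite gt_eqF.
have kapJ : kap ^+ 2 * K * L / 8 <= kap ^+ 2 * L * J.
  have k2 : 0 <= kap ^+ 2 * L by rewrite mulr_ge0 ?sqr_ge0 ?ltW.
  have := ler_wpM2l k2 (ltW KJ); lra.
lra.
Qed.

(** * The lower tail *)

Lemma measurable_edge_form d (T : measurableType d) (R : realType)
    (P : probability T R) n (Z : 'I_n -> 'I_n -> {RV P >-> R}) (m : R) c :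
  measurable_fun [set: T] (fun w => edge_form c (fun i j => Z i j w - m)).
Proof.
rewrite /edge_form; under eq_fun do rewrite -big_filter.
apply: measurable_sum => p; apply: measurable_funM => //.
exact: measurable_funB.
Qed.

Lemma measurable_lt_cst d (T : measurableType d) (R : realType)
    (f : T -> R) (r : R) :
  measurable_fun [set: T] f -> measurable [set w | f w < r].
Proof.
move=> mf; rewrite -[X in measurable X]/(f @^-1` [set x | x < r]).
rewrite -set_itvNyo -[X in measurable X]setTI; apply: mf => //.
Qed.

(** If no set is heavy then, for every transversal [a], either the centered form
    [Y_a] is below [(1 - kap) beta v], or what separates it from the weight is
    below [- kap K^(3/2) sqrt L].  The second alternative has an exponentially
    small probability by a union bound over the [exp (K L)] transversals. *)
Lemma lower_tail d (T : measurableType d) (R : realType)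
    (P : probability T R) n k m (Z : 'I_n -> 'I_n -> {RV P >-> R})
    (K M L kap h0 tau : R) (B : set T) :
  K = k%:R -> M = m%:R -> L = ln M ->
  iid_normal Z (1 / 2) (Num.sqrt (1 / 4)) ->
  (0 < k)%N -> (k * m <= n)%N -> 0 < kap <= 1 -> 0 <= tau -> 0 <= h0 ->
  128 ^+ 2 <= M -> 40 * L <= M -> 40 * (L * tau) <= h0 * M ->
  128 * (L * tau ^+ 2) <= h0 * K -> 128 * tau <= K ->
  K + 4 * L * K / M + 2 * L + tau <= kap ^+ 2 * K * L / 8 ->
  4 <= kap * M -> 2 <= kap * K -> 3 <= kap ^+ 2 * M ->
  measurable B ->
  (forall w (S : {set 'I_n}), B w -> #|S| = k ->
     subset_weight (fun i j => Z i j w) S < (K ^+ 2 - K) / 4 +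
       ((1 - kap) ^+ 3 / 2 - kap) * (K * Num.sqrt K * Num.sqrt L)) ->
  (P B <= (4 * expR (- (kap ^+ 2 * (1 - kap) ^+ 3 * (K * L))) +
           (expR h0 - 1) + k.+1%:R * expR (- tau) + expR (- (K * L)))%:E)%E.
Proof.
move=> KE ME LE iid k0 kmn /andP[kap0 kap1] tau0 h00 M128 LM LtM LtK tK big
  kapM kapK kap2M mB BP.
have K0 : 0 < K by rewrite KE ltr0n.
have M0 : 0 < M by lra.
have m0 : (0 < m)%N by rewrite -(ltr0n R) -ME.
have eL : expR L = M by rewrite LE lnK// posrE.
have eL2 : expR (- (L / 2)) <= 1 / 128.
  have : expR (L / 2) ^+ 2 = M by rewrite expr2 -expRD -eL; congr expR; lra.
  move=> e2; rewrite expRN div1r lef_pV2 ?posrE ?expR_gt0//.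
  by rewrite -ler_sqr ?nnegrE ?expR_ge0// e2.
have L0 : 0 < L by rewrite LE; apply: ln_gt0; lra.
set s : R := Num.sqrt (1 / 4) in iid.
have s2 : s ^+ 2 = 1 / 4 by rewrite sqr_sqrtr//; lra.
have s0 : s != 0 by rewrite gt_eqF// sqrtr_gt0; lra.
pose emb (p : 'I_k * 'I_m) : 'I_n :=
  widen_ord kmn (cast_ord (etrans (card_prod _ _)
    (congr2 muln (card_ord k) (card_ord m))) (enum_rank p)).
have emb_inj : injective emb.
  by move=> p p' /(congr1 val)/= /val_inj/enum_rank_inj.
pose A : finType := {ffun 'I_k -> 'I_m}.
pose h (a : A) := pair_prod (indicator_of R (transversal emb a)).
pose q (a : A) := pair_prod (centered R emb a).
pose x w := (fun i j => Z i j w - 1 / 2) : 'I_n -> 'I_n -> R.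
pose v : R := 1 / 4 * centered_norm R k m.
have /andP[nlo nhi] := centered_norm_bounds R k m0.
rewrite -KE -ME in nlo nhi.
have KM0 : 0 < K / M by rewrite divr_gt0.
have vlo : ((K - K / M) ^+ 2 - K) / 8 <= v.
  by rewrite /v; lra.
have vhi : v <= K ^+ 2 / 8 by rewrite /v; lra.
have vK : (1 - kap) * K ^+ 2 / 8 <= v.
  apply: le_trans vlo.
  have h1 : 4 * (K / M) <= kap * K.
    by rewrite mulrA ler_pdivrMr//; have := ler_wpM2r (ltW K0) kapM; lra.
  have := sqr_ge0 (K / M); have := ler_wpM2r (ltW K0) h1.
  have := ler_wpM2r (ltW K0) kapK; lra.
pose Q := Num.sqrt (L / K).
have Q2 : Q ^+ 2 = L / K by rewrite sqr_sqrtr// divr_ge0 ?ltW.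
have Q0 : 0 <= Q by exact: sqrtr_ge0.
have QE : K * Num.sqrt K * Num.sqrt L = K ^+ 2 * Q.
  rewrite /Q sqrtrM ?(ltW L0)// sqrtrV ?(ltW K0)//.
  have sK : Num.sqrt K != 0 by rewrite gt_eqF// sqrtr_gt0.
  have -> : K ^+ 2 = K * Num.sqrt K ^+ 2 by rewrite sqr_sqrtr ?expr2// ltW.
  by field.
(* The critical value is 4 Q: there beta^2 K^2 / 8 = 2 K L. *)
pose beta := 4 * (1 - kap) * Q.
have b0 : 0 <= beta by rewrite mulr_ge0// mulr_ge0//; lra.
have bK : beta ^+ 2 * K = 16 * (1 - kap) ^+ 2 * L.
  by rewrite exprMn Q2; field; rewrite gt_eqF.
pose u := (1 + kap) * beta * (K ^+ 2 / 8).
pose ag (a b : A) : R := (agree a b)%:R.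
(* For small overlaps theta = beta switches the truncation off. *)
pose theta (a b : A) := if 8 * ag a b <= K then beta
  else beta / (1 + (ag a b / K) ^+ 2).
pose Phi (j : nat) : R := if 8 * j%:R <= K then 2 * L * (j%:R - K / M) ^+ 2 / K
  else L * j%:R - K / M * (expR L - 1) - tau.
pose t := kap * (K ^+ 2 * Q).
pose B1 := [set w | forall a : A, True ->
  edge_form (q a) (x w) < (1 - kap) * beta * v].
pose B2 := [set w | exists a : A,
  t <= edge_form (fun p => - (h a p - q a p)) (x w)].
have mB1 : measurable B1.
  apply: (@measurable_forall_fin _ _ _ (fun=> True)
    (fun a => [set w | edge_form (q a) (x w) < (1 - kap) * beta * v])) => a.
  exact/measurable_lt_cst/measurable_edge_form.
have mB2 : measurable B2.
  rewrite -[B2]setCK; apply: measurableC.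
  rewrite (_ : ~` B2 = [set w | forall a : A, True ->
     edge_form (fun p => - (h a p - q a p)) (x w) < t]).
    apply: (@measurable_forall_fin _ _ _ (fun=> True)
      (fun a => [set w | edge_form (fun p => - (h a p - q a p)) (x w) < t])) => a.
    exact/measurable_lt_cst/measurable_edge_form.
  apply/seteqP; split => w /= wP.
    by move=> a _; rewrite ltNge; apply/negP => ta; apply: wP; exists a.
  by move=> [a]; rewrite leNgt wP.
have BB : B `<=` B1 `|` B2.
  move=> w Bw; have [B2w|nB2w] := pselect (B2 w); [by right|left] => a _.
  have := BP w (transversal emb a) Bw (card_transversal emb_inj a).
  rewrite (subset_weightE _ (1 / 2)) card_transversal// -/(x w) -/(h a) -KE QE.
  have : edge_form (fun p => - (h a p - q a p)) (x w) < t.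
    by rewrite ltNge; apply/negP => ta; apply: nB2w; exists a.
  have -> : edge_form (fun p => - (h a p - q a p)) (x w) =
      edge_form (q a) (x w) - edge_form (h a) (x w).
    by rewrite /edge_form -sumrB; apply: eq_bigr => p _; ring.
  rewrite /t.
  have : (1 - kap) ^+ 3 / 2 * (K ^+ 2 * Q) <= (1 - kap) * beta * v.
    have c0 : 0 <= (1 - kap) * beta by rewrite mulr_ge0//; lra.
    have := ler_wpM2l c0 vK; rewrite /beta; lra.
  lra.
have KL : K ^+ 2 * Q ^+ 2 = K * L by rewrite Q2; field; rewrite gt_eqF.
have cardA : #|A|%:R = expR (K * L) :> R.
  by rewrite /A card_ffun !card_ord natrX KE expRM_natl eL ME.
have PB1 : (P B1 <= (4 * expR (- (kap ^+ 2 * (1 - kap) ^+ 3 * (K * L))) +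
           (expR h0 - 1) + k.+1%:R * expR (- tau))%:E)%E.
  have A0 : (0 < #|A|)%N by rewrite -(ltr0n R) cardA expR_gt0.
  have v0 : 0 <= v.
    by apply: le_trans vK; rewrite !mulr_ge0 ?sqr_ge0 ?(ltW K0)//; lra.
  have uP : (1 + kap) * beta * v <= u.
    by rewrite /u ler_wpM2l// mulr_ge0//; lra.
  have thP a b : theta a b <= beta.
    rewrite /theta; case: ifP => // _.
    by rewrite ler_pdivrMr ?ltr_wpDr ?sqr_ge0// ler_peMr// lerDl sqr_ge0.
  have vE a : s ^+ 2 * edge_dot (q a) (q a) = v.
    by rewrite s2 edge_dot_centered.
  have B1P w a : B1 w -> edge_form (q a) (x w) < (1 - kap) * beta * v by apply.
  have := truncated_second_moment s0 iid A0 vE v0 b0 (ltW kap0) uP thP mB1 B1P.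
  move=> /le_trans; apply; rewrite lee_fin.
  have bv : 2 * ((1 - kap) ^+ 3 * (K * L)) <= beta ^+ 2 * v.
    have := ler_wpM2l (sqr_ge0 beta) vK.
    have -> : beta ^+ 2 * ((1 - kap) * K ^+ 2 / 8) =
        beta ^+ 2 * K * ((1 - kap) * K / 8).
      by ring.
    by rewrite bK; lra.
  have e_le : expR (- (kap ^+ 2 * beta ^+ 2 * v / 2)) <=
      expR (- (kap ^+ 2 * (1 - kap) ^+ 3 * (K * L))).
    by rewrite ler_expR; have := ler_wpM2l (sqr_ge0 kap) bv; lra.
  have le_Phi a b : 2 * (beta - theta a b) * u +
      theta a b ^+ 2 * (v + s ^+ 2 * edge_dot (q a) (q b)) - beta ^+ 2 * v <=
      Phi (agree a b).
    have V_le : s ^+ 2 * edge_dot (q a) (q b) <= (ag a b - K / M) ^+ 2 / 8.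
      have := edge_dot_centered_le R emb_inj m0 a b.
      by rewrite s2 -KE -ME -/(q a) -/(q b) -/(ag a b); lra.
    have agK : ag a b <= K.
      by rewrite KE ler_nat /agree -[leqRHS]card_ord max_card.
    rewrite /Phi /theta -/(ag a b); case: ifPn => [_|].
      rewrite subrr mulr0 mul0r add0r mulrDr addrAC subrr add0r.
      have := ler_wpM2l (sqr_ge0 beta) V_le => /le_trans; apply.
      have -> : beta ^+ 2 * ((ag a b - K / M) ^+ 2 / 8) =
          (1 - kap) ^+ 2 * (2 * L * (ag a b - K / M) ^+ 2 / K).
        have -> : beta ^+ 2 = beta ^+ 2 * K / K by rewrite mulfK// gt_eqF.
        by rewrite bK; field; rewrite !gt_eqF.
      rewrite ler_piMl//.
        by rewrite divr_ge0 ?(ltW K0)// mulr_ge0 ?sqr_ge0// mulr_ge0// ltW.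
      by rewrite exprn_ile1//; lra.
    rewrite -ltNge => lag.
    rewrite lerBrDr.
    apply: (@high_overlap_exponent R K M L tau kap (ag a b) beta _ u v) => //.
    - by rewrite kap0.
    - by rewrite ler0n.
    - by lra.
    - by rewrite vlo.
  have avg a : \sum_b expR (2 * (beta - theta a b) * u +
      theta a b ^+ 2 * (v + s ^+ 2 * edge_dot (q a) (q b)) - beta ^+ 2 * v) <=
      expR (K * L) * (expR h0 + k.+1%:R * expR (- tau)).
    have -> : expR (K * L) = m%:R ^+ k by rewrite KE expRM_natl eL ME.
    apply: (@le_trans _ _ (\sum_b expR (Phi (agree a b)))).
      by apply: ler_sum => b _; rewrite ler_expR.
    apply: sum_exp_fun_agree => // j jk; rewrite /Phi -KE -ME.
    case: ifPn => [J8|_].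
      exact: low_overlap_exponent.
    by right; exists L; rewrite subrK.
  have : #|A|%:R ^- 2 * \sum_a \sum_b expR (2 * (beta - theta a b) * u +
      theta a b ^+ 2 * (v + s ^+ 2 * edge_dot (q a) (q b)) - beta ^+ 2 * v) <=
      expR h0 + k.+1%:R * expR (- tau).
    have cA0 : 0 < #|A|%:R :> R by rewrite cardA expR_gt0.
    rewrite ler_pdivrMl ?exprn_gt0//.
    apply: le_trans (ler_sum _ (fun a _ => avg a)) _.
    rewrite sumr_const -[leLHS]mulr_natl -cardA expr2 -!mulrA.
    exact: lexx.
  lra.
have PB2 : (P B2 <= (expR (- (K * L)))%:E)%E.
  (* The linear gain 3 K L must exceed the entropy K L by at least K L plus the
     quadratic term. *)
  have th0 : 0 <= 3 * Q / kap by rewrite divr_ge0 ?mulr_ge0// ltW.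
  have cV (a : A) : predT a -> s ^+ 2 *
      edge_dot (fun p => - (h a p - q a p)) (fun p => - (h a p - q a p)) <=
      K ^+ 2 / (2 * M).
    move=> _; have -> : edge_dot (fun p => - (h a p - q a p))
        (fun p => - (h a p - q a p)) =
        edge_dot (fun p => h a p - q a p) (fun p => h a p - q a p).
      by apply: eq_bigr => p _; rewrite mulrNN.
    have := edge_dot_residual R emb_inj m0 a; rewrite s2 -KE -ME.
    have -> : 2 * K ^+ 2 / M = 4 * (K ^+ 2 / (2 * M)).
      by field; rewrite gt_eqF.
    by rewrite -/(h a) -/(q a); lra.
  have B2P w : B2 w -> exists2 a : A, predT a &
      t <= edge_form (fun p => - (h a p - q a p)) (x w).
    by move=> [a ta]; exists a.
  have := union_bound_exp s0 iid th0 cV mB2 B2P.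
  move=> /le_trans; apply; rewrite lee_fin.
  rewrite (_ : #|predT|%:R = expR (K * L)) -?cardA// cardA -expRD ler_expR.
  have -> : 3 * Q / kap * t = 3 * (K * L).
    by rewrite -KL /t; field; rewrite gt_eqF.
  have -> : (3 * Q / kap) ^+ 2 * (K ^+ 2 / (2 * M)) / 2 =
      (K ^+ 2 * Q ^+ 2) * (9 / (4 * (kap ^+ 2 * M))).
    by field; rewrite !gt_eqF.
  rewrite KL.
  have : 9 / (4 * (kap ^+ 2 * M)) <= 1 by rewrite ler_pdivrMr; lra.
  move=> /(ler_wpM2l (mulr_ge0 (ltW K0) (ltW L0))); lra.
have := leeD PB1 PB2; rewrite -EFinD; apply: le_trans.
have := measureU2 P mB1 mB2; apply: le_trans.
by apply: le_measure; rewrite ?inE//; exact: measurableU.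
Qed.

(** * The upper tail *)

Lemma binomial_le_exp (R : realType) (n k : nat) : (0 < k <= n)%N ->
  'C(n, k)%:R <= expR (k%:R * (ln (n%:R / k%:R) + 1)) :> R.
Proof.
move=> /andP[k0 kn].
have k0R : 0 < k%:R :> R by rewrite ltr0n.
have n0R : 0 < n%:R :> R by rewrite ltr0n (leq_trans k0).
have fact0 : 0 < k`!%:R :> R by rewrite ltr0n fact_gt0.
have -> : expR (k%:R * (ln (n%:R / k%:R) + 1)) =
    n%:R ^+ k / k%:R ^+ k * expR k%:R :> R.
  have -> : k%:R * (ln (n%:R / k%:R) + 1) = k%:R * ln (n%:R / k%:R) + k%:R :> R.
    by ring.
  rewrite expRD expRM_natl lnK ?posrE ?divr_gt0//.
  by rewrite exprMn exprVn.
have le_fact : k%:R ^+ k / k`!%:R <= expR k%:R :> R.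
  case: k k0 {kn k0R fact0} => // k _.
  by apply: le_trans (expR_ge1Dxn k (ler0n R k.+1)); rewrite lerDr.
have le_pow : 'C(n, k)%:R * k`!%:R <= n%:R ^+ k :> R.
  rewrite -natrM -natrX ler_nat bin_ffact ffact_prod.
  have -> : (n ^ k = \prod_(i < k) n)%N by rewrite prod_nat_const card_ord.
  by apply: leq_prod => i _; exact: leq_subr.
have -> : 'C(n, k)%:R = 'C(n, k)%:R * k`!%:R / k`!%:R :> R.
  by rewrite mulfK// gt_eqF.
apply: (@le_trans _ _ (n%:R ^+ k / k`!%:R)); first by rewrite ler_pM2r ?invr_gt0.
rewrite -mulrA ler_wpM2l ?exprn_ge0 ?ler0n//.
rewrite ler_pdivlMl ?exprn_gt0//.
Qed.

(** Union bound over the [K]-sets; the tilt [8 r / sqrt K] is the optimal one for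
    a Gaussian of variance [K^2 / 8]. *)
Lemma upper_tail d (T : measurableType d) (R : realType)
    (P : probability T R) n k (Z : 'I_n -> 'I_n -> {RV P >-> R})
    (K D r : R) (B : set T) :
  K = k%:R -> iid_normal Z (1 / 2) (Num.sqrt (1 / 4)) ->
  (0 < k <= n)%N -> 0 <= r -> ln (n%:R / K) + D <= 4 * r ^+ 2 ->
  measurable B ->
  (forall w, B w -> exists2 S : {set 'I_n}, #|S| = k &
     K ^+ 2 / 4 + K * Num.sqrt K * r <= subset_weight (fun i j => Z i j w) S) ->
  (P B <= (expR (K * (1 - D)))%:E)%E.
Proof.
move=> KE iid kn r0 rD mB BP.
have K0 : 0 < K by rewrite KE ltr0n; case/andP: kn.
set s : R := Num.sqrt (1 / 4) in iid.
have s2 : s ^+ 2 = 1 / 4 by rewrite sqr_sqrtr//; lra.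
have s0 : s != 0 by rewrite gt_eqF// sqrtr_gt0; lra.
have sK0 : 0 < Num.sqrt K by rewrite sqrtr_gt0.
have th0 : 0 <= 8 * r / Num.sqrt K by rewrite divr_ge0 ?mulr_ge0.
pose A : finType := {set 'I_n}.
pose Q : pred A := fun S => #|S| == k.
pose c (S : A) := pair_prod (indicator_of R S).
have cV S : Q S -> s ^+ 2 * edge_dot (c S) (c S) <= K ^+ 2 / 8.
  by move=> /eqP QS; rewrite s2 edge_dot_indicator QS -KE; lra.
have BP' w : B w -> exists2 S : A, Q S &
    K * Num.sqrt K * r <= edge_form (c S) (fun i j => Z i j w - 1 / 2).
  move=> /BP[S Sk]; rewrite (subset_weightE _ (1 / 2)) Sk -KE => le_S.
  by exists S; [exact/eqP|rewrite /c; lra].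
have := union_bound_exp s0 iid th0 cV mB BP'.
move=> /le_trans; apply; rewrite lee_fin.
have -> : #|Q| = 'C(n, k).
  rewrite -[n in RHS]card_ord -card_draws.
  by apply: eq_card => S; rewrite inE -topredE.
have -> : expR (K * (1 - D)) =
    expR (K * (ln (n%:R / K) + 1)) * expR (- (K * (ln (n%:R / K) + D))).
  by rewrite -expRD; congr expR; ring.
apply: ler_pM; rewrite ?expR_ge0 ?ler0n//.
  by rewrite KE binomial_le_exp.
rewrite ler_expR.
have -> : (8 * r / Num.sqrt K) ^+ 2 * (K ^+ 2 / 8) / 2 = K * (4 * r ^+ 2).
  rewrite -{2 3}(sqr_sqrtr (ltW K0)).
  by field; rewrite gt_eqF.
have -> : 8 * r / Num.sqrt K * (K * Num.sqrt K * r) = K * (8 * r ^+ 2).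
  by field; rewrite gt_eqF.
have := ler_wpM2l (ltW K0) rD; lra.
Qed.

(** * The event of the theorem *)

Lemma measurable_subset_weight d (T : measurableType d) (R : realType)
    (P : probability T R) n (Z : 'I_n -> 'I_n -> {RV P >-> R}) (S : {set 'I_n}) :
  measurable_fun [set: T] (fun w => subset_weight (fun i j => Z i j w) S).
Proof.
under eq_fun do rewrite (subset_weightE _ 0).
by apply: measurable_funD => //; exact: measurable_edge_form.
Qed.

Lemma max_weight_dist (R : realType) n k (z : 'I_n -> 'I_n -> R) (c e : R) :
  (k <= n)%N ->
  (`|max_weight z k - c%:E| <= e%:E)%E <->
  (forall S : {set 'I_n}, #|S| = k -> subset_weight z S <= c + e) /\
  (exists2 S : {set 'I_n}, #|S| = k & c - e <= subset_weight z S).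
Proof.
move=> kn.
have [S0 S0k S0max] : exists2 S0 : {set 'I_n}, #|S0| = k &
    max_weight z k = (subset_weight z S0)%:E /\
    forall S : {set 'I_n}, #|S| = k -> subset_weight z S <= subset_weight z S0.
  have [S1 S1k] : exists S1 : {set 'I_n}, #|S1| == k.
    have : (0 < #|[set A : {set 'I_n} | #|A| == k]%SET|)%N.
      by rewrite card_draws card_ord bin_gt0.
    by move=> /card_gt0P[S1]; rewrite inE => S1k; exists S1.
  case: (@Order.TotalTheory.arg_maxP _ _ _ S1 (fun S : {set 'I_n} => #|S| == k)
    (subset_weight z) S1k) => S0 /eqP S0k S0max.
  exists S0 => //; split; last by move=> S /eqP; exact: S0max.
  apply/eqP; rewrite eq_le; apply/andP; split.
    by apply: bigmax_le => [|S Sk]; rewrite ?leNye// lee_fin; exact: S0max.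
  by rewrite /max_weight (bigD1 S0) ?S0k//= le_max lexx.
case: S0max => -> S0max; rewrite -EFinB abse_EFin lee_fin ler_distl.
split=> [/andP[lo hi]|[hi [S Sk lo]]].
  by split=> [S /S0max/le_trans|]; [apply|exists S0].
by rewrite (hi _ S0k) (le_trans lo (S0max _ Sk)).
Qed.

Lemma max_weight_event d (T : measurableType d) (R : realType)
    (P : probability T R) n k (Z : 'I_n -> 'I_n -> {RV P >-> R})
    (c e p1 p2 : R) :
  let up := [set w | exists2 S : {set 'I_n}, #|S| = k &
    c + e < subset_weight (fun i j => Z i j w) S] in
  let lo := [set w | forall S : {set 'I_n}, #|S| = k ->
    subset_weight (fun i j => Z i j w) S < c - e] in
  let E := [set w | (`|max_weight (fun i j => Z i j w) k - c%:E| <= e%:E)%E] in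
  (k <= n)%N ->
  (measurable up -> P up <= p1%:E)%E -> (measurable lo -> P lo <= p2%:E)%E ->
  measurable E /\ ((1 - p1 - p2)%:E <= P E)%E.
Proof.
move=> up lo E kn Pup Plo.
have mlo : measurable lo.
  apply: (@measurable_forall_fin _ _ _ (fun S : {set 'I_n} => #|S| = k)
    (fun S => [set w | subset_weight (fun i j => Z i j w) S < c - e])) => S.
  exact/measurable_lt_cst/measurable_subset_weight.
have mup : measurable up.
  rewrite -[up]setCK; apply: measurableC.
  rewrite (_ : ~` up = [set w | forall S : {set 'I_n}, #|S| = k ->
      ~ (c + e < subset_weight (fun i j => Z i j w) S)]).
    apply: (@measurable_forall_fin _ _ _ (fun S : {set 'I_n} => #|S| = k)
      (fun S => ~` [set w | c + e < subset_weight (fun i j => Z i j w) S])) => S.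
    apply: measurableC.
    rewrite (_ : mkset _ =
      [set w | - subset_weight (fun i j => Z i j w) S < - (c + e)]).
      apply: measurable_lt_cst; apply: measurable_funN.
      exact: measurable_subset_weight.
    by apply/seteqP; split => w /=; rewrite ltrN2.
  apply/seteqP; split => w /= wP.
    by move=> S Sk lt_S; apply: wP; exists S.
  by move=> [S Sk]; exact: wP.
have EE : E = ~` (up `|` lo).
  apply/seteqP; split => w /=.
    move=> /(max_weight_dist _ _ _ kn)[hi [S Sk lo_S]] [[S' S'k]|/(_ S Sk)].
      by rewrite ltNge hi.
    by rewrite ltNge lo_S.
  move=> nul; apply/(max_weight_dist _ _ _ kn); split.
    move=> S Sk; rewrite leNgt; apply/negP => lt_S; apply: nul; left.
    by exists S.
  apply/not_exists2P => nex; apply: nul; right => S Sk.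
  by rewrite ltNge; apply/negP; case: (nex S).
have mul : measurable (up `|` lo) by exact: measurableU.
split; first by rewrite EE; exact: measurableC.
rewrite EE probability_setC//.
have -> : (1 - p1 - p2)%:E = (1 - (p1 + p2)%:E)%E.
  by rewrite -EFinB; congr EFin; lra.
apply: leeB => //.
have := leeD (Pup mup) (Plo mlo); rewrite -EFinD; apply: le_trans.
exact: measureU2.
Qed.

(** * Growth of the parameters and conclusion *)

Lemma near_le_ln (R : realType) (C : R) :
  \forall n \near \oo, C <= ln (n%:R : R).
Proof.
near=> n.
have Cn : expR C <= n%:R by near: n; exact: nbhs_infty_ger.
rewrite -[leLHS]expRK ler_ln ?posrE ?expR_gt0//.
by apply: lt_le_trans Cn; exact: expR_gt0.
Unshelve. all: by end_near. Qed.

(** [n^a = exp (a ln n)] is at least the fourth order term of its series. *)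
Lemma near_ln_le_powR (R : realType) (a C : R) : 0 < a ->
  \forall n \near \oo, C * ln n%:R ^+ 3 <= (n%:R : R) `^ a.
Proof.
move=> a0; near=> n.
have l0 : 1 <= ln (n%:R : R) by near: n; exact: near_le_ln.
have lC : C * 24 / a ^+ 4 <= ln (n%:R : R) by near: n; exact: near_le_ln.
have n0 : n%:R != 0 :> R.
  by apply: contraTneq l0 => ->; rewrite ln0// -ltNge.
rewrite /powR (negbTE n0); set l := ln n%:R in l0 lC *.
have al0 : 0 <= a * l by rewrite mulr_ge0 ?ltW//; lra.
apply: le_trans (expR_ge1Dxn 3 al0).
have -> : 4`!%:R = 24 :> R by [].
have l3 : 0 <= l ^+ 3 by rewrite exprn_ge0//; lra.
move: lC; rewrite ler_pdivrMr ?exprn_gt0// => /(ler_wpM2r l3); lra.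
Unshelve. all: by end_near. Qed.

Lemma powR_3half (R : realType) (x : R) : 0 <= x ->
  x `^ (3 / 2) = x * Num.sqrt x.
Proof.
move=> x0; have -> : 3 / 2 = 1 + 2^-1 :> R by lra.
by rewrite powRD ?powRr1 ?powR12_sqrt//; apply/implyP; lra.
Qed.

Section sizes.
Variables (R : realType) (alpha : R).
Hypotheses (alpha_gt0 : 0 < alpha) (alpha_lt1 : alpha < 1).
Let k (n : nat) := subset_size alpha n.
Let m (n : nat) := (n %/ k n)%N.

Lemma near_subset_size_ge (C : R) :
  \forall n \near \oo, C * ln n%:R ^+ 3 <= (k n)%:R :> R.
Proof.
near=> n.
have l1 : 1 <= ln (n%:R : R) by near: n; exact: near_le_ln.
have : (C + 1) * ln (n%:R : R) ^+ 3 <= n%:R `^ alpha.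
  by near: n; exact: near_ln_le_powR.
have /andP[_] := truncn_itv (powR_ge0 (n%:R : R) alpha).
rewrite -/(k n) -natr1.
have : 1 <= ln (n%:R : R) ^+ 3 by exact: exprn_ege1.
lra.
Unshelve. all: by end_near. Qed.

Lemma near_block_count_ge (C : R) :
  \forall n \near \oo, C * ln n%:R ^+ 3 <= (m n)%:R :> R.
Proof.
near=> n.
have l1 : 1 <= ln (n%:R : R) by near: n; exact: near_le_ln.
have k1 : 1 * ln n%:R ^+ 3 <= (k n)%:R :> R by near: n; exact: near_subset_size_ge.
have : (C + 1) * ln (n%:R : R) ^+ 3 <= n%:R `^ (1 - alpha).
  by near: n; apply: near_ln_le_powR; rewrite subr_gt0.
have l3 : 1 <= ln (n%:R : R) ^+ 3 by exact: exprn_ege1.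
have k0 : 0 < (k n)%:R :> R by lra.
have n0 : 0 < n%:R :> R.
  by rewrite ltNge; apply/negP => n0; move: l1; rewrite ln0// ler10.
have kle : (k n)%:R <= (n%:R : R) `^ alpha.
  by have /andP[] := truncn_itv (powR_ge0 (n%:R : R) alpha).
have nlt : n%:R < ((m n)%:R + 1) * (k n)%:R :> R.
  rewrite natr1 -natrM ltr_nat; apply: ltn_ceil.
  by rewrite -(ltr0n R).
have nk : n%:R `^ (1 - alpha) * (k n)%:R <= n%:R :> R.
  apply: (@le_trans _ _ ((n%:R : R) `^ (1 - alpha) * n%:R `^ alpha)).
    by rewrite ler_wpM2l ?powR_ge0.
  rewrite -powRD ?subrK ?powRr1 ?ler0n//.
  by apply/implyP => _; rewrite gt_eqF.
have : n%:R `^ (1 - alpha) < (m n)%:R + 1 :> R.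
  by rewrite -(ltr_pM2r k0); exact: le_lt_trans nlt.
lra.
Unshelve. all: by end_near. Qed.

End sizes.

Lemma ln_divn (R : realType) (n k : nat) : (0 < k <= n)%N ->
  [/\ ln (n %/ k)%:R <= ln n%:R :> R, 0 <= ln (n%:R / k%:R) :> R &
      ln (n%:R / k%:R) <= ln (n %/ k)%:R + 1 :> R].
Proof.
move=> /andP[k0 kn]; set m := (n %/ k)%N.
have m0 : (0 < m)%N by rewrite divn_gt0.
have K0 : 0 < k%:R :> R by rewrite ltr0n.
have M0 : 0 < m%:R :> R by rewrite ltr0n.
have n0 : 0 < n%:R :> R by rewrite ltr0n (leq_trans k0).
split.
- by rewrite ler_ln ?posrE// ler_nat leq_div.
- by apply: ln_ge0; rewrite ler_pdivlMr// mul1r ler_nat.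
have -> : ln m%:R + 1 = ln (expR 1 * m%:R) :> R.
  by rewrite lnM ?posrE ?expR_gt0// expRK addrC.
rewrite ler_ln ?posrE ?divr_gt0 ?mulr_gt0 ?expR_gt0// ler_pdivrMr//.
have nM : n%:R < (m%:R + 1) * k%:R :> R.
  by rewrite natr1 -natrM ltr_nat; exact: ltn_ceil.
have eM : (m%:R + 1) * k%:R <= expR 1 * m%:R * k%:R :> R.
  rewrite ler_pM2r//; apply: (@le_trans _ _ ((1 + 1) * m%:R)).
    by rewrite mulrDl mul1r lerD2l ler1n.
  by rewrite ler_pM2r//; exact: expR_ge1Dx.
exact: ltW (lt_le_trans nM eM).
Qed.

(** Meant for [La = ln (n / K)], [L = ln (n %/ k)] and [l = ln n].  The square root
    of [La] exceeds that of [L] by at most one, which is negligible against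
    [sqrt l], and the relative loss [1 - (1 - kap)^3 + 2 kap] is at most
    [5 kap <= eps]. *)
Lemma main_term_gap (R : realType) (kap eps K L La l : R) :
  0 < eps -> 0 < kap <= 1 -> kap <= eps / 5 -> 1 <= K -> 0 <= L <= l ->
  La <= L + 1 -> (3 / (2 * eps)) ^+ 2 <= l ->
  K ^+ 2 / 4 + K * Num.sqrt K * Num.sqrt La / 2 -
    eps * (K * Num.sqrt K * Num.sqrt l) <=
  (K ^+ 2 - K) / 4 +
    ((1 - kap) ^+ 3 / 2 - kap) * (K * Num.sqrt K * Num.sqrt L).
Proof.
move=> eps0 /andP[kap0 kap1] kapeps K1 /andP[L0 Ll] LaL leps.
have K0 : 0 <= K by exact: le_trans K1.
have sL0 : 0 <= Num.sqrt L by exact: sqrtr_ge0.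
have sl0 : 0 <= Num.sqrt l by exact: sqrtr_ge0.
have sLl : Num.sqrt L <= Num.sqrt l by rewrite ler_wsqrtr.
have sLa : Num.sqrt La <= Num.sqrt L + 1.
  rewrite -[leRHS]ger0_norm ?addr_ge0// -sqrtr_sqr ler_wsqrtr//.
  rewrite sqrrD sqr_sqrtr// expr1n mulr1; apply: le_trans LaL _.
  by rewrite lerD2r lerDl mulrn_wge0.
have seps : 3 / 2 <= eps * Num.sqrt l.
  have : 3 / (2 * eps) <= Num.sqrt l.
    rewrite -[leLHS]ger0_norm ?divr_ge0 ?mulr_ge0 ?(ltW eps0)//.
    by rewrite -sqrtr_sqr ler_wsqrtr.
  rewrite ler_pdivrMr ?mulr_gt0// => seps; clear -seps; lra.
have KsK : K <= K * Num.sqrt K.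
  by rewrite ler_peMr// -sqrtr1 ler_wsqrtr.
have bern : 1 - 3 * kap <= (1 - kap) ^+ 3.
  have : 0 <= kap ^+ 2 * (3 - kap).
    by rewrite mulr_ge0 ?sqr_ge0// subr_ge0 (le_trans kap1)// ler1n.
  clear; lra.
have core : 1 / 4 + Num.sqrt La / 2 -
    ((1 - kap) ^+ 3 / 2 - kap) * Num.sqrt L <= eps * Num.sqrt l.
  have := ler_wpM2r sL0 bern; have := ler_wpM2r sl0 kapeps.
  have := ler_wpM2l (ltW kap0) sLl; clear -sLa seps; lra.
have := ler_wpM2l (le_trans K0 KsK) core; clear -KsK; lra.
Qed.

(** The hypotheses of [lower_tail] for [tau = 3 l]. *)
Lemma growth_conditions (R : realType) (kap h0 K M L l : R) :
  0 < kap <= 1 -> 0 < h0 -> 1 <= l -> L <= l -> 24 / kap ^+ 2 <= L ->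
  384 * l ^+ 3 <= K -> 1152 / h0 * l ^+ 3 <= K -> 2 / kap * l ^+ 3 <= K ->
  128 ^+ 2 * l ^+ 3 <= M -> 120 / h0 * l ^+ 3 <= M -> 4 / kap * l ^+ 3 <= M ->
  3 / kap ^+ 2 * l ^+ 3 <= M ->
  [/\ 128 ^+ 2 <= M, 40 * L <= M, 40 * (L * (3 * l)) <= h0 * M,
      128 * (L * (3 * l) ^+ 2) <= h0 * K & 128 * (3 * l) <= K] /\
  [/\ K + 4 * L * K / M + 2 * L + 3 * l <= kap ^+ 2 * K * L / 8,
      4 <= kap * M, 2 <= kap * K & 3 <= kap ^+ 2 * M].
Proof.
move=> /andP[kap0 kap1] h00 l1 Ll Lk K1 K2 K3 M1 M2 M3 M4.
have l0 : 0 <= l by exact: le_trans l1.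
have k20 : 0 < kap ^+ 2 by rewrite exprn_gt0.
have l3 : l <= l ^+ 3 by rewrite exprS ler_peMr ?exprn_ege1.
have l2 : l ^+ 2 <= l ^+ 3 by rewrite [leRHS]exprS ler_peMl ?exprn_ge0.
have drop C x : 0 <= C -> C * l ^+ 3 <= x -> C <= x.
  by move=> C0; apply: le_trans; rewrite ler_peMr// exprn_ege1.
have M128 : 128 ^+ 2 <= M by apply: drop M1; exact: exprn_ge0.
have M0 : 0 < M by apply: lt_le_trans M128; exact: exprn_gt0.
have lM : 128 ^+ 2 * l <= M by clear -M1 l3; lra.
have lK : 384 * l <= K by clear -K1 l3; lra.
have K0 : 0 < K by clear -lK l1; lra.
split; split => //.
- by clear -lM Ll l1; lra.
- have hM : 120 * l ^+ 3 <= h0 * M.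
    by move: M2; rewrite mulrAC ler_pdivrMr// [M * _]mulrC.
  have Lll : L * l <= l * l by rewrite ler_wpM2r.
  by clear -hM Lll l2; lra.
- have hK : 1152 * l ^+ 3 <= h0 * K.
    by move: K2; rewrite mulrAC ler_pdivrMr// [K * _]mulrC.
  have Lll : L * l ^+ 2 <= l * l ^+ 2 by rewrite ler_wpM2r// sqr_ge0.
  by clear -hK Lll; lra.
- by clear -lK; lra.
- have LKM : 4 * L * K / M <= K.
    by rewrite ler_pdivrMr// [leRHS]mulrC ler_pM2r//; clear -lM Ll l1; lra.
  have : 24 <= kap ^+ 2 * L by rewrite mulrC -ler_pdivrMr.
  move=> /(ler_wpM2r (ltW K0)) main.
  by clear -LKM main lK Ll l1; lra.
- have := drop _ _ (divr_ge0 (ler0n R 4) (ltW kap0)) M3.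
  by rewrite ler_pdivrMr// mulrC.
- have := drop _ _ (divr_ge0 (ler0n R 2) (ltW kap0)) K3.
  by rewrite ler_pdivrMr// mulrC.
- have := drop _ _ (divr_ge0 (ler0n R 3) (ltW k20)) M4.
  by rewrite ler_pdivrMr// mulrC.
Qed.

(** The failure probability in [lower_tail] for [tau = 3 l]: this choice of [tau]
    beats the factor [k + 1 <= 2 n <= exp (2 l)]. *)
Lemma lower_error_le (R : realType) (n k : nat) (kc w L eta8 : R) :
  let K : R := k%:R in let l : R := ln n%:R in
  (forall x, x <= - w -> expR x <= eta8) -> (0 < k <= n)%N ->
  0 < kc -> 1 <= L -> 1 <= l -> w <= l -> w <= K -> w / kc <= K ->
  4 * expR (- (kc * (K * L))) + eta8 + k.+1%:R * expR (- (3 * l)) +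
    expR (- (K * L)) <= 7 * eta8.
Proof.
move=> K l small /andP[k0 kn] kc0 L1 l1 wl wK wkc.
have n0 : 0 < n%:R :> R by rewrite ltr0n (leq_trans k0).
have el : expR l = n%:R by rewrite lnK.
have KL : K <= K * L by rewrite ler_peMr.
have e1 : expR (- (kc * (K * L))) <= eta8.
  apply: small; rewrite lerN2 mulrC -ler_pdivrMr//.
  exact: le_trans wkc KL.
have e2 : expR (- (K * L)) <= eta8.
  by apply: small; rewrite lerN2; exact: le_trans wK KL.
have e3 : k.+1%:R * expR (- (3 * l)) <= eta8.
  apply: le_trans (small (- l) _); last by rewrite lerN2.
  have -> : - l = l + l + - (3 * l) by ring.
  rewrite !expRD el ler_pM2r ?expR_gt0//.
  have n2 : 2 <= n%:R :> R.
    by rewrite -el (le_trans _ (expR_ge1Dx l))// -[2]/(1 + 1) lerD2l.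
  apply: (@le_trans _ _ (2 * n%:R)); last by rewrite ler_pM2r.
  rewrite -natrM ler_nat mul2n -addnn -addn1.
  by rewrite leq_add// (leq_trans k0).
by clear -e1 e2 e3; lra.
Qed.

(** The threshold for [n] is uniform over the probability spaces, because the
    spaces of the theorem change with [n]. *)
Lemma typical_max_weight (R : realType) (alpha : R) (eps eta : R) :
  0 < alpha -> alpha < 1 -> 0 < eps -> 0 < eta ->
  \forall n \near \oo, forall (d : measure_display) (T : measurableType d)
    (P : probability T R) (Z : 'I_n -> 'I_n -> {RV P >-> R}),
  iid_normal Z (1 / 2) (Num.sqrt (1 / 4)) ->
  let k := subset_size alpha n in let K : R := k%:R in
  let E := [set w | (`|max_weight (fun i j => Z i j w) k -
    (K ^+ 2 / 4 + K `^ (3 / 2) * Num.sqrt (ln (n%:R / K)) / 2)%:E| <=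
    (eps * (K `^ (3 / 2) * Num.sqrt (ln n%:R)))%:E)%E] in
  measurable E /\ ((1 - eta)%:E <= P E)%E.
Proof.
move=> al0 al1 eps0 eta0.
pose kap := Num.min (1 / 2) (eps / 5).
have kap0 : 0 < kap by rewrite lt_min; apply/andP; split; lra.
have kap2 : kap <= 1 / 2 by rewrite ge_min lexx.
have kapeps : kap <= eps / 5 by rewrite ge_min lexx orbT.
have kap01 : 0 < kap <= 1 by apply/andP; split; lra.
(* There are eight error terms: four equal ones in the truncation, and one each
   from h0, tau, the residual forms and the upper tail. *)
pose eta8 := eta / 8.
have eta80 : 0 < eta8 by rewrite /eta8; lra.
pose h0 := ln (1 + eta8).
have h00 : 0 < h0 by apply: ln_gt0; lra.
have eh : expR h0 - 1 = eta8 by rewrite lnK ?posrE; lra.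
pose w := Num.max 1 (- ln eta8).
have small x : x <= - w -> expR x <= eta8.
  move=> xw; rewrite -[leRHS]lnK ?posrE// ler_expR.
  have : - ln eta8 <= w by rewrite le_max lexx orbT.
  lra.
have w1 : 1 <= w by rewrite le_max lexx.
pose kc := kap ^+ 2 * (1 - kap) ^+ 3.
have kc0 : 0 < kc by rewrite mulr_gt0 ?exprn_gt0//; lra.
have kap24 : 1 <= 24 / kap ^+ 2.
  rewrite ler_pdivlMr ?exprn_gt0// mul1r.
  by apply: (@le_trans _ _ 1); rewrite ?ler1n// exprn_ile1//; lra.
pose l_ (n : nat) : R := ln n%:R.
pose K_ (n : nat) : R := (subset_size alpha n)%:R.
pose M_ (n : nat) : R := (n %/ subset_size alpha n)%:R.
have K_ge C : \forall n \near \oo, C * l_ n ^+ 3 <= K_ n.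
  exact: near_subset_size_ge.
have M_ge C : \forall n \near \oo, C * l_ n ^+ 3 <= M_ n.
  exact: near_block_count_ge.
have l_ge C : \forall n \near \oo, C <= l_ n by exact: near_le_ln.
near=> n.
have l1 : 1 <= l_ n by near: n; exact: l_ge.
have lw : w <= l_ n by near: n; exact: l_ge.
have leps : (3 / (2 * eps)) ^+ 2 <= l_ n by near: n; exact: l_ge.
have leps2 : 2 / (4 * eps ^+ 2) <= l_ n by near: n; exact: l_ge.
have K1 : 384 * l_ n ^+ 3 <= K_ n by near: n; exact: K_ge.
have K2 : 1152 / h0 * l_ n ^+ 3 <= K_ n by near: n; exact: K_ge.
have K3 : 2 / kap * l_ n ^+ 3 <= K_ n by near: n; exact: K_ge.
have K4 : w / kc * l_ n ^+ 3 <= K_ n by near: n; exact: K_ge.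
have K5 : w * l_ n ^+ 3 <= K_ n by near: n; exact: K_ge.
have M1 : 128 ^+ 2 * l_ n ^+ 3 <= M_ n by near: n; exact: M_ge.
have M2 : 120 / h0 * l_ n ^+ 3 <= M_ n by near: n; exact: M_ge.
have M3 : 4 / kap * l_ n ^+ 3 <= M_ n by near: n; exact: M_ge.
have M4 : 3 / kap ^+ 2 * l_ n ^+ 3 <= M_ n by near: n; exact: M_ge.
have M5 : expR (24 / kap ^+ 2) * l_ n ^+ 3 <= M_ n by near: n; exact: M_ge.
move=> d T P Z iid; set k := subset_size alpha n.
pose m := (n %/ k)%N; pose K : R := k%:R; pose M : R := m%:R.
pose l : R := ln n%:R; pose L := ln M; pose La := ln (n%:R / K).
rewrite -[(subset_size alpha n)%:R]/K.
have drop C x : 0 <= C -> C * l ^+ 3 <= x -> C <= x.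
  by move=> C0; apply: le_trans; rewrite ler_peMr// exprn_ege1.
have w0 : 0 <= w by exact: le_trans w1.
have wK : w <= K by exact: drop K5.
have wkc : w / kc <= K by apply: drop K4; rewrite divr_ge0// ltW.
have K1' : 1 <= K by exact: le_trans wK.
have K0 : 0 < K by exact: lt_le_trans K1'.
have eM : expR (24 / kap ^+ 2) <= M by apply: drop M5; exact: expR_ge0.
have M0 : 0 < M by apply: lt_le_trans eM; exact: expR_gt0.
have k0 : (0 < k)%N by rewrite -(ltr0n R).
have m0 : (0 < m)%N by rewrite -(ltr0n R).
have kmn : (k * m <= n)%N by rewrite mulnC; exact: leq_divM.
have kn : (0 < k <= n)%N by rewrite k0 (leq_trans _ kmn)// leq_pmulr.
have [Ll La0 LaL] := ln_divn R kn.
have Lk : 24 / kap ^+ 2 <= L by rewrite -ler_expR [expR L]lnK.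
have L1 : 1 <= L by exact: le_trans Lk.
have L0 : 0 <= L <= l by rewrite (le_trans _ L1).
rewrite powR_3half ?(ltW K0)//.
have -> : eta = eta8 + 7 * eta8 by rewrite /eta8; clear; lra.
rewrite opprD addrA.
apply: max_weight_event => [|mB|mB]; first by case/andP: kn.
- apply: le_trans (@upper_tail _ _ _ P n k Z K (4 * eps ^+ 2 * l)
    (Num.sqrt La / 2 + eps * Num.sqrt l) _ erefl iid kn _ _ mB _) _.
  + by rewrite addr_ge0 ?divr_ge0 ?sqrtr_ge0// mulr_ge0 ?sqrtr_ge0// ltW.
  + rewrite -/La -{1}(sqr_sqrtr (La0 : 0 <= La)).
    have -> : 4 * eps ^+ 2 * l = 4 * (eps * Num.sqrt l) ^+ 2.
      by rewrite exprMn sqr_sqrtr ?mulrA// (le_trans _ l1).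
    have := mulr_ge0 (sqrtr_ge0 La) (mulr_ge0 (ltW eps0) (sqrtr_ge0 l)).
    by clear; lra.
  + move=> x [S Sk /ltW le_S]; exists S => //.
    by apply: le_trans le_S; rewrite -/La -/l; clear; lra.
  rewrite lee_fin; apply: small.
  have e2l : 2 <= 4 * eps ^+ 2 * l.
    by rewrite mulrC -ler_pdivrMr// mulr_gt0// exprn_gt0.
  have := ler_wpM2l (ltW K0) e2l; clear -wK; lra.
- have [[c1 c2 c3 c4 c5] [c6 c7 c8 c9]] := growth_conditions
    kap01 h00 l1 Ll Lk K1 K2 K3 M1 M2 M3 M4.
  apply: le_trans (@lower_tail _ _ _ P n k m Z K M L kap h0 (3 * l) _
    erefl erefl erefl iid k0 kmn kap01 _ (ltW h00) c1 c2 c3 c4 c5 c6 c7 c8 c9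
    mB _) _.
  + by rewrite mulr_ge0// (le_trans _ l1).
  + move=> x S lo_x Sk; apply: lt_le_trans (lo_x S Sk) _.
    exact: main_term_gap.
  rewrite lee_fin eh.
  exact: (lower_error_le small kn kc0 L1 l1 lw wK wkc).
Unshelve. all: by end_near. Qed.

Theorem corollary2p9 (R : realType) (alpha : R)
    (alpha_gt0 : 0 < alpha) (alpha_lt1 : alpha < 1)
    (d : nat -> measure_display) (T : forall n : nat, measurableType (d n))
    (P : forall n : nat, probability (T n) R)
    (Z : forall n : nat, 'I_n -> 'I_n -> {RV (P n) >-> R})
    (Z_iid : forall n : nat, iid_normal (Z n) (1 / 2) (Num.sqrt (1 / 4)))
    (eps : R) (eps_gt0 : 0 < eps) :
  (fun n : nat =>
     let k := subset_size alpha n in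
     let K : R := k%:R in
     P n [set w : T n |
       (`| max_weight (fun i j => Z n i j w) k
           - (K ^+ 2 / 4 + K `^ (3 / 2) * Num.sqrt (ln (n%:R / K)) / 2)%:E |
        <= (eps * (K `^ (3 / 2) * Num.sqrt (ln n%:R)))%:E)%E])
    @ \oo --> 1%E.
Proof.
pose E n := [set w : T n |
  (`|max_weight (fun i j => Z n i j w) (subset_size alpha n)
     - ((subset_size alpha n)%:R ^+ 2 / 4
        + (subset_size alpha n)%:R `^ (3 / 2)
          * Num.sqrt (ln (n%:R / (subset_size alpha n)%:R)) / 2)%:E|
   <= (eps * ((subset_size alpha n)%:R `^ (3 / 2) * Num.sqrt (ln n%:R)))%:E)%E].
have typical eta : 0 < eta ->
    \forall n \near \oo, measurable (E n) /\ ((1 - eta)%:E <= P n (E n))%E.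
  move=> eta0.
  apply: filterS (typical_max_weight alpha_gt0 alpha_lt1 eps_gt0 eta0) => n typ.
  exact: typ (Z_iid n).
rewrite -[X in X @ _ --> _]/(fun n => P n (E n)).
have fin : \forall n \near \oo, P n (E n) \is a fin_num.
  near=> n; have [mE _] : measurable (E n) /\ ((1 - 1)%:E <= P n (E n))%E.
    by near: n; exact: typical.
  exact: fin_num_measure.
apply/fine_cvgP; split => //; apply/cvgrPdist_le => eta eta0; near=> n.
have [mE leE] : measurable (E n) /\ ((1 - eta)%:E <= P n (E n))%E.
  by near: n; exact: typical.
have Efin : P n (E n) \is a fin_num by exact: fin_num_measure.
have leE1 : (P n (E n) <= 1)%E by exact: probability_le1.
move: leE leE1; rewrite -(fineK Efin) !lee_fin /= => lo hi.
by rewrite ger0_norm; lra.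
Unshelve. all: by end_near. Qed.
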